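(* Let $\varphi\in[0,2\pi)$, $\theta\in(-\frac\pi2,0)\cup(0,\frac\pi2)$, $a,b\in\mathbb{C}$ with $b\neq0$, $k,m\in\mathbb{R}$, and $$L=T_\theta\begin{pmatrix} a&b&0&0\\ e^{2ik}\bar b&a+me^{ik}&0&0\\ 0&0&a&e^{-2i\theta}b\\ 0&0&e^{2i\theta}e^{2ik}\bar b&a+me^{ik}\end{pmatrix}T_\theta^\dagger,\qquad T_\theta=\begin{pmatrix}1&0&0&0\\ 0&ie^{-i\varphi}\sin\theta&\cos\theta&0\\ 0&-\cos\theta&-ie^{i\varphi}\sin\theta&0\\ 0&0&0&1\end{pmatrix}.$$ For an initial two-qubit state $\rho(0)$ let $\rho_{as}(t)$ be its asymptotic dynamics under the semigroup generated by $L$ and $H$, and let $|y|$ be the (time-independent) modulus of the off-diagonal element $\langle0|\cdot|1\rangle$ of a reduced single-qubit state of $\rho_{as}(t)$ (it is the same for both qubits). As $\rho(0)$ ranges over all two-qubit density operators, the visibility $2|y|$ ranges from $0$ to the maximal value $\frac12|\sin 2\theta|$, independently of $\varphi$. In particular, over all admissible $\theta$ the largest maximum is $\frac12$, attained at $\theta=\pm\frac\pi4$.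
   Context: Hilbert space $\mathbb{C}^2\otimes\mathbb{C}^2$, $|ij\rangle=|i\rangle\otimes|j\rangle$; matrices are in the ordered basis $(|00\rangle,|01\rangle,|10\rangle,|11\rangle)$. $H=H_0\otimes I+I\otimes H_0$ with $H_0=\mathrm{diag}(E_0,E_1)$, $E_0,E_1\in\mathbb{R}$, $\Delta E=E_0-E_1\neq0$. The generator is $\mathcal L(\rho)=-i[H,\rho]+L\rho L^\dagger-\frac12\{L^\dagger L,\rho\}$, $\mathcal T_t=e^{t\mathcal L}$. The attractor space is the direct sum of $\ker(\mathcal L-\lambda I)$ over all purely imaginary eigenvalues $\lambda$ (including $0$) of $\mathcal L$. The asymptotic dynamics of $\rho(t)=\mathcal T_t(\rho(0))$ is the trajectory $\rho_{as}(t)=\mathcal T_t(\rho_{as}(0))$ inside the attractor space with $\lim_{t\to\infty}\|\rho(t)-\rho_{as}(t)\|=0$. The visibility $2|y|$ is the amplitude of the oscillation $\langle\sigma_x\rangle(t)=2|y|\cos(\Delta E\,t+\mu)$ of the local observable $\sigma_x$ in the asymptotic reduced state. *)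

(* Defs.v *)
From HB Require Import structures.
From mathcomp Require Import all_boot all_order all_algebra.
From mathcomp Require Import all_classical all_reals all_analysis.
From mathcomp Require Import complex mxtens.

Set Implicit Arguments.
Unset Strict Implicit.
Unset Printing Implicit Defensive.

Import Order.TTheory GRing.Theory Num.Theory numFieldNormedType.Exports.
Local Open Scope classical_set_scope.
Local Open Scope ring_scope.
Local Open Scope complex_scope.
Local Open Scope sesquilinear_scope.

Section QuantumSemigroup.
Context {R : realType}.
Local Notation C := R[i].

Definition cis (x : R) : C := cos x +i* sin x.

(* R[i] carries no topology in the library, so limits of complex sequences are
   taken on real and imaginary parts. *)
Definition climn (u : nat -> C) : C :=
  limn (fun n => complex.Re (u n)) +i* limn (fun n => complex.Im (u n)).

Section Superoperators.
Context {n : nat}.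
Implicit Types (X Y A B L H rho : 'M[C]_n) (G : 'M[C]_n -> 'M[C]_n).

Definition commutator A B : 'M[C]_n := A *m B - B *m A.
Definition anticommutator A B : 'M[C]_n := A *m B + B *m A.

Definition density rho : Prop :=
  [/\ rho ^t* = rho,
      forall v : 'cV[C]_n, 0 <= (v ^t* *m rho *m v) 0 0
    & \tr rho = 1].

Definition hs_norm X : R :=
  Num.sqrt (\sum_i \sum_j ComplexField.Normc.normc (X i j) ^+ 2).

Definition lindblad H L rho : 'M[C]_n :=
  - ('i%C *: commutator H rho) + L *m rho *m L ^t*
  - 2^-1 *: anticommutator (L ^t* *m L) rho.

(* exp(t G) applied to X: the series \sum_k (t ^ k / k!) G^k(X), summed entry by
   entry. *)
Definition semigroup G (t : R) X : 'M[C]_n :=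
  \matrix_(i, j) climn (fun N =>
    (\sum_(k < N) (t ^+ k / k`!%:R)%:C *: iter k G X) i j).

(* Sum of the spaces ker (G - (i w) I), w real; eigenspaces of distinct
   eigenvalues being independent, this is the direct sum. *)
Definition attractor_space G : set 'M[C]_n :=
  [set X | exists (p : nat) (w : 'I_p -> R) (Y : 'I_p -> 'M[C]_n),
     (forall l, G (Y l) = ((w l)%:C * 'i%C) *: Y l) /\ X = \sum_l Y l].

(* X is the initial point rho_as(0); the asymptotic trajectory is
   t |-> semigroup G t X.  All norms being equivalent in finite dimension, the
   Hilbert-Schmidt one is used. *)
Definition asymptotic_start G rho X : Prop :=
  (forall t : R, 0 <= t -> attractor_space G (semigroup G t X)) /\
  (hs_norm (semigroup G t rho - semigroup G t X) @[t --> +oo] --> (0 : R)).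

End Superoperators.

(* Two qubits: mxtens_index (i, j) has value 2 * i + j, so the indices 0, 1, 2,
   3 stand for |00>, |01>, |10>, |11>. *)
Definition mx22 (s : seq (seq C)) : 'M[C]_(2 * 2) :=
  \matrix_(i, j) nth 0 (nth [::] s i) j.

Definition H0 (E0 E1 : R) : 'M[C]_2 :=
  diag_mx (\row_(j < 2) (if j == 0 then E0 else E1)%:C).

Definition hamiltonian (E0 E1 : R) : 'M[C]_(2 * 2) :=
  H0 E0 E1 *t 1%:M + 1%:M *t H0 E0 E1.

Definition Tmx (phi theta : R) : 'M[C]_(2 * 2) :=
  let c := (cos theta)%:C in let s := (sin theta)%:C in
  mx22 [:: [:: 1; 0; 0; 0];
           [:: 0; 'i%C * cis (- phi) * s; c; 0];
           [:: 0; - c; - ('i%C * cis phi * s); 0];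
           [:: 0; 0; 0; 1]].

Definition lindblad_op (a b : C) (k m phi theta : R) : 'M[C]_(2 * 2) :=
  let d := a + m%:C * cis k in
  let b' := cis (2 * k) * Num.conj b in
  Tmx phi theta
  *m mx22 [:: [:: a; b; 0; 0];
              [:: b'; d; 0; 0];
              [:: 0; 0; a; cis (- (2 * theta)) * b];
              [:: 0; 0; cis (2 * theta) * b'; d]]
  *m (Tmx phi theta) ^t*.

Definition reduced1 (X : 'M[C]_(2 * 2)) : 'M[C]_2 :=
  \matrix_(i, j) \sum_(l < 2) X (mxtens_index (i, l)) (mxtens_index (j, l)).

Definition reduced2 (X : 'M[C]_(2 * 2)) : 'M[C]_2 :=
  \matrix_(i, j) \sum_(l < 2) X (mxtens_index (l, i)) (mxtens_index (l, j)).

Definition sigma_x : 'M[C]_2 := \matrix_(i, j) (i != j)%:R.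

(* Along the trajectory starting at X, both reduced states have an off-diagonal
   element <0|.|1> of constant modulus y. *)
Definition coherence (G : 'M[C]_(2 * 2) -> 'M[C]_(2 * 2))
    (X : 'M[C]_(2 * 2)) (y : R) : Prop :=
  forall t : R, 0 <= t ->
    ComplexField.Normc.normc (reduced1 (semigroup G t X) 0 1) = y /\
    ComplexField.Normc.normc (reduced2 (semigroup G t X) 0 1) = y.

(* On the trajectory starting at X, <sigma_x> oscillates on each qubit with
   angular frequency dE and amplitude v; the phases may differ. *)
Definition oscillates (G : 'M[C]_(2 * 2) -> 'M[C]_(2 * 2))
    (dE : R) (X : 'M[C]_(2 * 2)) (v : R) : Prop :=
  (exists mu : R, forall t : R, 0 <= t ->
     \tr (sigma_x *m reduced1 (semigroup G t X)) = (v * cos (dE * t + mu))%:C) /\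
  (exists mu : R, forall t : R, 0 <= t ->
     \tr (sigma_x *m reduced2 (semigroup G t X)) = (v * cos (dE * t + mu))%:C).

Definition visibilities (G : 'M[C]_(2 * 2) -> 'M[C]_(2 * 2)) : set R :=
  [set v | exists (rho X : 'M[C]_(2 * 2)) (y : R),
     [/\ density rho, asymptotic_start G rho X, coherence G X y & v = 2 * y]].

Definition admissible (theta : R) : Prop :=
  [/\ - (pi / 2) < theta, theta < pi / 2 & theta != 0].

End QuantumSemigroup.

(* Main.v *)
Require Import Defs.
From HB Require Import structures.
From mathcomp Require Import all_boot all_order all_algebra.
From mathcomp Require Import all_classical all_reals all_analysis.
From mathcomp Require Import complex mxtens.
From mathcomp Require Import ring lra.
Set Implicit Arguments.
Unset Strict Implicit.
Unset Printing Implicit Defensive.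
Import Order.TTheory GRing.Theory Num.Theory numFieldNormedType.Exports.
Local Open Scope classical_set_scope.
Local Open Scope ring_scope.
Local Open Scope complex_scope.
Local Open Scope sesquilinear_scope.

(* In the basis given by the columns of T_theta, the last one multiplied by
   e^{2 i theta}, both 2x2 blocks of L become the same matrix l, so the two
   qubits decouple into copies of one qubit: with g the Lindbladian of (H_0, l)
   on 2x2 matrices, the generator maps the block matrix (A, B; D, E) to
   (g A, g B - i dE B; g D + i dE D, g E).
   As l = a + e^{ik} K with K hermitian, l is normal, and the energy identity
   2 Re <X, g X> = - |[l, X]|^2 forces every eigenvector of g with Re lam >= 0 to
   commute with l and H_0, i.e. to be scalar (b and dE are nonzero).  Hence the
   attractors are the matrices with four scalar blocks, all traceless blocks
   decay to 0, and the asymptotic state replaces each block of the initial state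
   by its mean diagonal entry.  Only the block B feeds the coherence, so that
   2|y| = |tr B| |sin (2 theta)|, where |tr B| <= 1/2 by positivity, and every
   value in [0, 1/2] occurs. *)

(** * Exponential series of a linear map *)

(** In the frame the space is again a product of two qubits, but virtual ones: the noise acts on the
    second factor only, while the first precesses freely with frequency [dE]. An attractor is an
    arbitrary 2x2 matrix on the first factor tensored with the identity, so asymptotically the
    second virtual qubit is maximally mixed. The constant 1/2 is the largest off-diagonal entry of a
    qubit state, here that of the first virtual qubit. The factor |sin (2 theta)| measures how much
    of this coherence each physical qubit sees: a physical coherence is a sum of two frame terms
    whose relative phase, up to sign, is the e^{-2 i theta} inherited from the last column, and
    their interference gives 2 cos theta or 2 sin theta. No diagonalization of the generator is
    available, and Jordan blocks are not excluded. Decay is therefore derived from an annihilating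
    polynomial, each factor giving a scalar equation z' = lam z + w with a forcing [w] already known
    to vanish. *)

Section ExponentialSeries.
Context {R : realType}.

(** Geometric growth of [c], which powers of a bounded operator satisfy, makes the exponential
    series at [M * |x|] a dominating series. *)
Lemma is_cvg_pseries_fact (c : R^nat) (A M : R) :
  0 <= M -> (forall k, `|c k| <= A * M ^+ k) ->
  forall x, cvgn (pseries (fun k => c k / k`!%:R) x).
Proof.
move=> M0 cM x; apply: normed_cvg.
apply: (@series_le_cvg _ _ (A *: exp_coeff (M * `|x|))) => [k|k|k|].
- exact: normr_ge0.
- rewrite /= /exp_coeff /= mulr_ge0 //; last first.
    by rewrite divr_ge0 // exprn_ge0 // mulr_ge0.
  by have := le_trans (normr_ge0 _) (cM 0%N); rewrite expr0 mulr1.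
- rewrite /= (_ : (A *: _) k = A * ((M * `|x|) ^+ k / k`!%:R)) // exprMn !normrM normfV normr_nat normrX.
  rewrite [leLHS]mulrAC (mulrA A) (mulrA A) ler_wpM2r ?invr_ge0 //.
  by rewrite ler_wpM2r ?exprn_ge0.
- apply: is_cvg_seriesZ; exact: is_cvg_series_exp_coeff.
Qed.

(** Differentiating an exponential generating series shifts its coefficients; for [c k] an entry of
    [iter k G X], the shift replaces [X] by [G X]. *)
Lemma pseries_diffs_fact (c : R^nat) :
  pseries_diffs (fun k => c k / k`!%:R) = (fun k => c k.+1 / k`!%:R).
Proof.
apply/funext => k; rewrite /pseries_diffs factS natrM invfM mulrCA; congr (_ * _).
by rewrite mulVKf // pnatr_eq0.
Qed.

Lemma is_derive_pseries_fact (c : R^nat) (A M : R) (x : R) :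
  0 <= M -> (forall k, `|c k| <= A * M ^+ k) ->
  is_derive x 1 (fun x => limn (pseries (fun k => c k / k`!%:R) x))
    (limn (pseries (fun k => c k.+1 / k`!%:R) x)).
Proof.
move=> M0 cM.
have cM1 (d : R^nat) B : (forall k, `|d k| <= B * M ^+ k) ->
    forall k, `|d k.+1| <= (B * M) * M ^+ k.
  by move=> dB k; rewrite -mulrA -exprS.
rewrite -pseries_diffs_fact.
(* Termwise differentiation asks for convergence of the series and of its first two formal
   derivatives at a point of modulus larger than [|x|]; each shift only multiplies the constant [A]
   by [M]. *)
apply: (@pseries_snd_diffs _ _ (`|x| + 1)).
- exact: is_cvg_pseries_fact cM _.
- rewrite pseries_diffs_fact; apply: is_cvg_pseries_fact (cM1 _ _ cM) _ => //.
- rewrite !pseries_diffs_fact.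
  exact: is_cvg_pseries_fact (cM1 _ _ (cM1 _ _ cM)) _.
- by rewrite [ltRHS]ger0_norm ?addr_ge0 // ltrDl.
Qed.

End ExponentialSeries.

Section RealAndImaginaryParts.
Context {R : realType}.
Local Notation C := R[i].
Local Notation normc := ComplexField.Normc.normc.

(** Limits and derivatives are those of real functions; the boolean lets one argument serve for both
    parts. *)
Definition cpart (im : bool) (z : C) : R :=
  if im then complex.Im z else complex.Re z.

Lemma cpart0 p : cpart p 0 = 0. Proof. by case: p. Qed.

Lemma cpartD p z w : cpart p (z + w) = cpart p z + cpart p w.
Proof. by case: p z w => [] [? ?] [? ?]. Qed.

Lemma cpart_sum p (I : Type) (r : seq I) (P : pred I) (F : I -> C) :
  cpart p (\sum_(i <- r | P i) F i) = \sum_(i <- r | P i) cpart p (F i).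
Proof. exact: (big_morph _ (cpartD p) (cpart0 p)). Qed.

Lemma cpart_real p (x : R) z : cpart p (x%:C * z) = x * cpart p z.
Proof. by case: p z => [] [a b] /=; rewrite mul0r ?subr0 ?addr0. Qed.

Lemma cpartP z w : (forall p, cpart p z = cpart p w) -> z = w.
Proof.
case: z w => a b [c d] e.
by have /= -> := e false; have /= -> := e true.
Qed.

Lemma normc_normr (z : C) : `|z| = (normc z)%:C.
Proof. by case: z. Qed.

Lemma sqr_normc_ReIm (z : C) :
  normc z ^+ 2 = complex.Re z ^+ 2 + complex.Im z ^+ 2.
Proof. by case: z => a b /=; rewrite sqr_sqrtr // addr_ge0 ?sqr_ge0. Qed.

Lemma normc_ge0 (z : C) : 0 <= normc z.
Proof. by case: z => a b; exact: sqrtr_ge0. Qed.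

Lemma cpart_le p z : `|cpart p z| <= normc z.
Proof.
rewrite -ler_sqr ?nnegrE ?normc_ge0 // real_normK ?num_real //.
by rewrite sqr_normc_ReIm; case: p => /=; rewrite ?lerDl ?lerDr sqr_ge0.
Qed.

Lemma normc_le_parts z : normc z <= `|cpart false z| + `|cpart true z|.
Proof.
rewrite -ler_sqr ?nnegrE ?normc_ge0 ?addr_ge0 // sqr_normc_ReIm sqrrD /=.
by rewrite !real_normK ?num_real // -addrA lerD2l lerDr mulrn_wge0 // mulr_ge0.
Qed.

Lemma normc_cis (x : R) : normc (cis x) = 1.
Proof. by rewrite /= cos2Dsin2 sqrtr1. Qed.

End RealAndImaginaryParts.

Section LinearSemigroup.
Context {R : realType} {n : nat}.
Local Notation C := R[i].
Local Notation normc := ComplexField.Normc.normc.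
Variable G : {linear 'M[C]_n -> 'M[C]_n}.
Implicit Types (X Y : 'M[C]_n) (i j : 'I_n) (p : bool) (t : R).

Let entry_sum X : R := \sum_i \sum_j normc (X i j).

Let normc_entry X i j : normc (X i j) <= entry_sum X.
Proof.
rewrite /entry_sum (bigD1 i) //= (bigD1 j) //= -addrA lerDl addr_ge0 //.
  by apply: sumr_ge0 => *; exact: normc_ge0.
by apply: sumr_ge0 => *; apply: sumr_ge0 => *; exact: normc_ge0.
Qed.

Let normc_sum (I : Type) (r : seq I) (F : I -> C) :
  normc (\sum_(i <- r) F i) <= \sum_(i <- r) normc (F i).
Proof.
elim/big_rec2: _ => [|i x y _ h]; first by rewrite ComplexField.Normc.normc0.
by rewrite (le_trans (le_normcD _ _)) // lerD2l.
Qed.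

(** Expanding [X] in matrix units bounds [G] in the entrywise l^1 norm, with constant the sum of the
    norms of the images of the matrix units. *)
Let entry_sum_linear : exists2 M : R, 0 <= M &
  forall X, entry_sum (G X) <= M * entry_sum X.
Proof.
pose M := \sum_i \sum_j entry_sum (G (delta_mx i j)).
have es0 X : 0 <= entry_sum X.
  by apply: sumr_ge0 => *; apply: sumr_ge0 => *; exact: normc_ge0.
exists M => [|X]; first by apply: sumr_ge0 => *; apply: sumr_ge0.
have esM X' i j : entry_sum (G (X' i j *: delta_mx i j)) <=
    entry_sum X' * entry_sum (G (delta_mx i j)).
  have esZ a (Y : 'M[C]_n) : entry_sum (a *: Y) = normc a * entry_sum Y.
    rewrite /entry_sum mulr_sumr; apply: eq_bigr => k _.
    rewrite mulr_sumr; apply: eq_bigr => l _.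
    by rewrite mxE ComplexField.Normc.normcM.
  by rewrite linearZ esZ ler_wpM2r.
have esS (I : finType) (F : I -> 'M[C]_n) :
    entry_sum (\sum_i F i) <= \sum_i entry_sum (F i).
  rewrite /entry_sum [leRHS]exchange_big; apply: ler_sum => k _.
  rewrite [leRHS]exchange_big; apply: ler_sum => l _.
  by rewrite summxE normc_sum.
rewrite [X in G X]matrix_sum_delta linear_sum mulrC /M mulr_sumr.
apply: le_trans (esS _ _) _; apply: ler_sum => i _.
rewrite linear_sum mulr_sumr; apply: le_trans (esS _ _) _.
by apply: ler_sum => j _; exact: esM.
Qed.

Let c p X i j k : R := cpart p (iter k G X i j).

Let c_bound p X i j : exists A M : R, 0 <= M /\
  forall k, `|c p X i j k| <= A * M ^+ k.
Proof.
have [M M0 GM] := entry_sum_linear; exists (entry_sum X), M; split=> // k.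
apply: le_trans (cpart_le _ _) _; apply: le_trans (normc_entry _ _ _) _.
elim: k => [|k ih] /=; first by rewrite expr0 mulr1.
by apply: le_trans (GM _) _; rewrite exprS mulrCA ler_wpM2l.
Qed.

Let partial p X t i j N :
  cpart p ((\sum_(k < N) (t ^+ k / k`!%:R)%:C *: iter k G X) i j) =
  pseries (fun k => c p X i j k / k`!%:R) t N.
Proof.
rewrite summxE cpart_sum /pseries /series /= big_mkord.
by apply: eq_bigr => k _; rewrite mxE cpart_real mulrC mulrAC mulrA.
Qed.

Let cpart_semigroup p X t i j :
  cpart p (semigroup G t X i j) = limn (pseries (fun k => c p X i j k / k`!%:R) t).
Proof.
have <- : limn (fun N => cpart p
    ((\sum_(k < N) (t ^+ k / k`!%:R)%:C *: iter k G X) i j)) =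
    limn (pseries (fun k => c p X i j k / k`!%:R) t).
  by congr (limn _); apply/funext => N; exact: partial.
by rewrite mxE; case: p.
Qed.

Lemma cvg_semigroup p X t i j :
  (fun N => cpart p ((\sum_(k < N) (t ^+ k / k`!%:R)%:C *: iter k G X) i j))
    @ \oo --> cpart p (semigroup G t X i j).
Proof.
rewrite cpart_semigroup (funext (partial p X t i j)).
have [A [M [M0 cM]]] := c_bound p X i j.
exact: is_cvg_pseries_fact cM _.
Qed.

Arguments cvg_semigroup : clear implicits.

Let semigroup_lim p X t i j (l : R) :
  (fun N => cpart p ((\sum_(k < N) (t ^+ k / k`!%:R)%:C *: iter k G X) i j))
    @ \oo --> l -> cpart p (semigroup G t X i j) = l.
Proof. exact: norm_cvg_unique (cvg_semigroup p X t i j). Qed.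

(** The derivative keeps [G] inside the semigroup, so that it is again an entry of a trajectory, the
    one started at [G X]. *)
Lemma is_derive_semigroup p X t i j :
  is_derive t 1 (fun t : R => cpart p (semigroup G t X i j))
    (cpart p (semigroup G t (G X) i j)).
Proof.
have [A [M [M0 cM]]] := c_bound p X i j.
rewrite (funext (fun t => cpart_semigroup p X t i j)) cpart_semigroup.
have -> : (fun k => c p (G X) i j k / k`!%:R) =
          (fun k => c p X i j k.+1 / k`!%:R).
  by apply/funext => k; rewrite /c iterSr.
exact: is_derive_pseries_fact M0 cM.
Qed.

Let iterD k X Y : iter k G (X + Y) = iter k G X + iter k G Y.
Proof. by elim: k => [//|k ih] /=; rewrite ih linearD. Qed.

Let iterZ k a X : iter k G (a *: X) = a *: iter k G X.
Proof. by elim: k => [//|k ih] /=; rewrite ih linearZ. Qed.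

Lemma semigroupD t X Y :
  semigroup G t (X + Y) = semigroup G t X + semigroup G t Y.
Proof.
apply/matrixP => i j; rewrite [RHS]mxE; apply: cpartP => p; rewrite cpartD.
apply: semigroup_lim.
have e N : (\sum_(k < N) (t ^+ k / k`!%:R)%:C *: iter k G (X + Y)) i j =
    (\sum_(k < N) (t ^+ k / k`!%:R)%:C *: iter k G X) i j +
    (\sum_(k < N) (t ^+ k / k`!%:R)%:C *: iter k G Y) i j.
  rewrite !summxE -big_split; apply: eq_bigr => k _.
  by rewrite iterD scalerDr mxE.
under eq_fun => N do rewrite e cpartD.
exact: cvgD (cvg_semigroup p X t i j) (cvg_semigroup p Y t i j).
Qed.

Lemma semigroupZ t a X : semigroup G t (a *: X) = a *: semigroup G t X.
Proof.
apply/matrixP => i j; rewrite [RHS]mxE.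
have e N : (\sum_(k < N) (t ^+ k / k`!%:R)%:C *: iter k G (a *: X)) i j =
    a * (\sum_(k < N) (t ^+ k / k`!%:R)%:C *: iter k G X) i j.
  rewrite !summxE mulr_sumr; apply: eq_bigr => k _.
  by rewrite iterZ !mxE mulrCA.
apply: cpartP => p; apply: semigroup_lim.
rewrite (funext (fun N => congr1 (cpart p) (e N))).
have := cvg_semigroup false X t i j; have := cvg_semigroup true X t i j.
case: a {e} => u v; set s := fun N : nat => _; set s' := fun N : nat => _.
move=> hi hr.
case: p.
- have -> : (fun N => cpart true ((u +i* v) *
    (\sum_(k < N) (t ^+ k / k`!%:R)%:C *: iter k G X) i j)) =
    (fun N => u * s N + v * s' N).
    by apply/funext => N; rewrite /s /s'; case: (fun_of_matrix _ _ _).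
  rewrite (_ : cpart true _ = u * cpart true (semigroup G t X i j) +
    v * cpart false (semigroup G t X i j)); last by case: (semigroup _ _ _ _ _).
  by apply: cvgD; apply: cvgM => //; exact: cvg_cst.
- have -> : (fun N => cpart false ((u +i* v) *
    (\sum_(k < N) (t ^+ k / k`!%:R)%:C *: iter k G X) i j)) =
    (fun N => u * s' N - v * s N).
    by apply/funext => N; rewrite /s /s'; case: (fun_of_matrix _ _ _).
  rewrite (_ : cpart false _ = u * cpart false (semigroup G t X i j) -
    v * cpart true (semigroup G t X i j)); last by case: (semigroup _ _ _ _ _).
  by apply: cvgB; apply: cvgM => //; exact: cvg_cst.
Qed.

Lemma semigroup0 X : semigroup G 0 X = X.
Proof.
apply/matrixP => i j; apply: cpartP => p.
apply: semigroup_lim.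
(* The partial sum for [N = 0] is empty, so the sequence is constant only after a shift by one. *)
rewrite -(cvg_shiftn 1) (_ : (fun N => _) = fun=> cpart p (X i j)).
  exact: cvg_cst.
apply/funext => N; rewrite addn1 big_ord_recl big1 => [|k _]; last first.
  by rewrite expr0n mul0r scale0r.
by rewrite expr0 divr1 scale1r addr0.
Qed.

Lemma semigroup_eigen X (w t : R) :
  G X = (w%:C * 'i%C) *: X -> semigroup G t X = cis (w * t) *: X.
Proof.
move=> GX.
have it k : iter k G X = (w%:C * 'i%C) ^+ k *: X.
  by elim: k => [|k ih] /=; rewrite ?expr0 ?scale1r // ih linearZZ GX scalerA exprSr.
(* Powers of i in the shape of [cos_coeff] and [sin_coeff]: a parity flag times a sign. *)
have ik k : 'i%C ^+ k = ((~~ odd k)%:R * (-1) ^ k./2) +i* ((odd k)%:R * (-1) ^+ k.-1./2) :> C.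
  elim/ltn_ind: k => -[|[|k]] ih.
  - by rewrite expr0 /= !mul1r mul0r.
  - by rewrite expr1 /= !mul1r mul0r.
  - rewrite !exprS mulrA -expr2 sqr_i ih // mulN1r /= !negbK.
    case: k ih => [|k] ih; first by rewrite /= mul1r !mul0r /GRing.opp /= oppr0 mul1r.
    rewrite (_ : uphalf k.+1 = (k.+1.-1./2).+1) // exprSz exprS !mulN1r.
    by rewrite !mulrN.
apply/matrixP => i j; rewrite [RHS]mxE.
pose T N := \sum_(k < N) (t ^+ k / k`!%:R)%:C * (w%:C * 'i%C) ^+ k.
have e N : (\sum_(k < N) (t ^+ k / k`!%:R)%:C *: iter k G X) i j = T N * X i j.
  by rewrite summxE mulr_suml; apply: eq_bigr => k _; rewrite it !mxE mulrA.
have Te N : T N = series (cos_coeff (w * t)) N +i* series (sin_coeff (w * t)) N.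
  have te k : (t ^+ k / k`!%:R)%:C * (w%:C * 'i%C) ^+ k =
      cos_coeff (w * t) k +i* sin_coeff (w * t) k.
    rewrite exprMn ik -rmorphXn mulrA -rmorphM /cos_coeff /sin_coeff /= exprMn.
    by apply/eqP; rewrite eq_complex /=; apply/andP; split; apply/eqP; ring.
  rewrite /T /series /=; elim: N => [|N ih]; first by rewrite !big_geq // big_ord0.
  by rewrite !big_nat_recr //= big_ord_recr /= ih te.
have cc : series (cos_coeff (w * t)) @ \oo --> cos (w * t).
  by rewrite cos.unlock; exact: is_cvg_series_cos_coeff.
have cs : series (sin_coeff (w * t)) @ \oo --> sin (w * t).
  by rewrite sin.unlock; exact: is_cvg_series_sin_coeff.
apply: cpartP => p; apply: semigroup_lim.
rewrite (funext (fun N => congr1 (cpart p) (e N))).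
rewrite (funext (fun N => congr1 (fun z => cpart p (z * _)) (Te N))).
rewrite /cis; case: (X i j) => a b; case: p => /=.
  by apply: cvgD; apply: cvgM => //; exact: cvg_cst.
by apply: cvgB; apply: cvgM => //; exact: cvg_cst.
Qed.

End LinearSemigroup.

(** * Decay of forced linear equations *)

Section LinearDecay.
Context {R : realType}.
Local Notation C := R[i].
Local Notation normc := ComplexField.Normc.normc.

(** Once [h < s * e], the function [(g - e) * expR (s * t)] has nonpositive derivative, hence stays
    below its value at [T1]; dividing by the growing exponential leaves [g < 2 * e], and [e] is half
    of [eps]. *)
Lemma gronwall_cvg0 (g dg h : R -> R) (s : R) : 0 < s ->
  (forall t : R, is_derive t 1 g (dg t)) -> (forall t, 0 <= g t) ->
  (forall t, dg t <= h t - s * g t) ->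
  h t @[t --> +oo] --> 0 -> g t @[t --> +oo] --> 0.
Proof.
move=> s0 dgP g0 dgle h0; apply/cvgrPdist_lt => eps eps0.
pose e := eps / 2; have e0 : 0 < e by rewrite divr_gt0.
have /cvgrPdist_lt/(_ _ (mulr_gt0 s0 e0)) [T [_ hT]] := h0.
pose T1 := T + 1.
pose phi (t : R) := (g t - e) * expR (s * t).
have dphi (t : R) :
    is_derive t 1 phi ((g t - e) * (s * expR (s * t)) + expR (s * t) * dg t).
  have D1 := dgP t.
  have D2 : is_derive t 1 (fun t => expR (s * t)) (s * expR (s * t)).
    have D3 : is_derive t 1 (fun t : R => s * t) s.
      have := is_deriveZ s (is_derive_id t (1 : R)).
      by rewrite [_ *: 1]mulr1.
    have D4 := is_derive_expR (s * t).
    have := @is_derive1_comp _ _ (fun t : R => s * t) t _ _ D4 D3.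
    by rewrite mulrC.
  have D5 : is_derive t 1 (fun t => g t - e) (dg t).
    have := is_deriveB D1 (is_derive_cst e t (1 : R)).
    by rewrite subr0.
  exact: is_deriveM D5 D2.
have phile (t : R) : T1 <= t -> phi t <= phi T1.
  move=> Tt; apply: (@ler0_derive1_nincry _ phi T1) => // [x|].
  - rewrite in_itv /= andbT => Tx; rewrite derive1E.
    have -> := @derive_val _ _ _ _ _ _ _ (dphi x).
    rewrite mulrA mulrC -mulrDr mulr_ge0_le0 ?expR_ge0 //.
    have hx : `|0 - h x| < s * e.
      by apply: hT; rewrite (lt_trans _ Tx) // /T1 ltrDl.
    have := ler_norm (h x); rewrite sub0r normrN in hx => hn.
    by have := dgle x; nra.
  - apply: continuous_subspaceT => x; apply: differentiable_continuous.
    by apply/derivable1_diffP; apply: ex_derive; exact: dphi.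
near=> t; rewrite sub0r normrN ger0_norm //.
have Tt : T1 <= t by near: t; apply: nbhs_pinfty_ge; exact: num_real.
have bt : (`|phi T1| / e - 1) / s < t.
  by near: t; apply: nbhs_pinfty_gt; exact: num_real.
(* The linear bound on [t] becomes an exponential one through [1 + x <= expR x]. *)
have {}bt : `|phi T1| < e * expR (s * t).
  rewrite mulrC -ltr_pdivrMr //; apply: lt_le_trans (expR_ge1Dx _).
  by rewrite -ltrBlDl [s * t]mulrC -ltr_pdivrMr.
have lt1 : (g t - e) * expR (s * t) < e * expR (s * t).
  exact: le_lt_trans (phile _ Tt) (le_lt_trans (ler_norm _) bt).
rewrite ltr_pM2r ?expR_gt0 // in lt1.
by rewrite (splitr eps) -ltrBlDr.
Unshelve. all: by end_near. Qed.

Definition vanishes (z : R -> C) : Prop := normc (z t) @[t --> +oo] --> (0 : R).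

Lemma vanishes_le (z : R -> C) (f : R -> R) :
  (forall t, normc (z t) <= f t) -> f t @[t --> +oo] --> 0 -> vanishes z.
Proof.
move=> zf f0; apply: (@squeeze_cvgr _ _ _ _ (fun=> 0) f) => //.
  by apply: nearW => t; rewrite normc_ge0 zf.
exact: cvg_cst.
Qed.

Lemma vanishesD z w : vanishes z -> vanishes w -> vanishes (fun t => z t + w t).
Proof.
move=> z0 w0; apply: (vanishes_le (fun t => le_normcD (z t) (w t))).
by rewrite -[0]addr0; exact: cvgD.
Qed.

Lemma vanishesZ a z : vanishes z -> vanishes (fun t => a * z t).
Proof.
move=> z0; apply: (@vanishes_le _ (fun t => normc a * normc (z t))) => [t|].
  by rewrite ComplexField.Normc.normcM.
by rewrite -(mulr0 (normc a)); apply: cvgM => //; exact: cvg_cst.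
Qed.

Lemma vanishes_sum (I : Type) (r : seq I) (F : I -> R -> C) :
  (forall i, vanishes (F i)) -> vanishes (fun t => \sum_(i <- r) F i t).
Proof.
move=> F0; elim: r => [|i r ih].
  under [X in vanishes X]eq_fun => t do rewrite big_nil.
  by rewrite /vanishes ComplexField.Normc.normc0; exact: cvg_cst.
under [X in vanishes X]eq_fun => t do rewrite big_cons.
exact: vanishesD.
Qed.

Lemma vanishesP z :
  vanishes z <-> forall p, cpart p (z t) @[t --> +oo] --> 0.
Proof.
split=> [z0 p|z0].
  apply/norm_cvg0P; apply: (@squeeze_cvgr _ _ _ _ (fun=> 0) (fun t => normc (z t))) => //.
    by apply: nearW => t; rewrite normr_ge0 cpart_le.
  exact: cvg_cst.
apply: (vanishes_le (fun t => normc_le_parts (z t))).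
by rewrite -[0]addr0; apply: cvgD; apply/norm_cvg0P.
Qed.

(* The energy |z|^2 obeys a Gronwall inequality, the forcing term being absorbed
   by 2 Re (z^* w) <= s |z|^2 + |w|^2 / s. *)
Lemma forced_decay (z w : R -> C) (lam : C) : complex.Re lam < 0 ->
  (forall p (t : R), is_derive t 1 (fun t => cpart p (z t))
     (cpart p (lam * z t + w t))) ->
  vanishes w -> vanishes z.
Proof.
move=> lam0 dz w0.
have [s [l2 [s0 lamE]]] : exists s l2, 0 < s /\ lam = (- s) +i* l2.
  exists (- complex.Re lam), (complex.Im lam); rewrite oppr_gt0 opprK.
  by case: lam lam0 {dz}.
rewrite {lam lam0}lamE in dz.
pose g (t : R) := cpart false (z t) ^+ 2 + cpart true (z t) ^+ 2.
pose h (t : R) := (cpart false (w t) ^+ 2 + cpart true (w t) ^+ 2) / s.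
pose dg (t : R) := 2 * (cpart false (z t) * cpart false (((- s) +i* l2) * z t + w t) +
                  cpart true (z t) * cpart true (((- s) +i* l2) * z t + w t)).
have dgP (t : R) : is_derive t 1 g (dg t).
  have D1 := is_deriveX 2 (dz false t); have D2 := is_deriveX 2 (dz true t).
  have D : is_derive t 1 g _ := is_deriveD D1 D2.
  by apply: (is_derive_eq D); rewrite /dg /GRing.scale /= !expr1; ring.
have g0 : g t @[t --> +oo] --> 0.
  apply: (@gronwall_cvg0 g dg h s) => // [t|t|].
  - by rewrite addr_ge0 ?sqr_ge0.
  - rewrite /dg /h /g; case: (z t) => x y; case: (w t) => u v.
    rewrite -subr_ge0 (_ : _ - _ = ((s * x - u) ^+ 2 + (s * y - v) ^+ 2) / s).
      by rewrite divr_ge0 ?addr_ge0 ?sqr_ge0 // ltW.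
    by rewrite /=; field; rewrite gt_eqF.
  - have sq p : cpart p (w t) ^+ 2 @[t --> +oo] --> 0.
      have /vanishesP/(_ p) wp := w0.
      under eq_fun => t do rewrite expr2.
      by rewrite -(mulr0 0); exact: cvgM.
    rewrite -(mul0r s^-1) -[X in X * _]addr0.
    by apply: cvgM; [exact: cvgD | exact: cvg_cst].
apply/vanishesP => p; apply/norm_cvg0P.
have -> : (fun t => `|cpart p (z t)|) = (fun t => Num.sqrt (cpart p (z t) ^+ 2)).
  by apply/funext => t; rewrite sqrtr_sqr.
rewrite -sqrtr0; apply: continuous_cvg; first exact: sqrt_continuous.
apply: (@squeeze_cvgr _ _ _ _ (fun=> 0) g) => //; last exact: cvg_cst.
apply: nearW => t; rewrite sqr_ge0 /= /g.
by case: p; rewrite ?lerDl ?lerDr sqr_ge0.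
Qed.

End LinearDecay.

(** * Decay on a stable subspace *)

Section StableSubspace.
Context {R : realType} {n : nat}.
Local Notation C := R[i].
Variable G : {linear 'M[C]_n -> 'M[C]_n}.
(** An invariant subspace given as a predicate; closure under [X - a *: Y] is what applying a factor
    [G - lam] uses. *)
Variable S : 'M[C]_n -> Prop.
Hypothesis S_lin : forall a X Y, S X -> S Y -> S (X - a *: Y).
Hypothesis S_inv : forall X, S X -> S (G X).
Hypothesis S_eigen : forall X lam, S X -> G X = lam *: X ->
  0 <= complex.Re lam -> X = 0.

Let shift lam X := G X - lam *: X.
Let shifts (s : seq C) X := foldl (fun Y lam => shift lam Y) X s.

Let S_shifts s X : S X -> S (shifts s X).
Proof. by elim: s X => [|l s ih] X SX //=; apply/ih/S_lin => //; exact: S_inv. Qed.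

Let shiftC l m X : shift l (shift m X) = shift m (shift l X).
Proof.
have GB Y Z : G (Y - Z) = G Y - G Z by exact: linearB.
have GZ a Y : G (a *: Y) = a *: G Y by exact: linearZZ.
rewrite /shift !GB !GZ !scalerBr !scalerA [l * m]mulrC.
by rewrite !opprB addrACA [RHS]addrACA; congr (_ + _); rewrite addrC.
Qed.

Let shifts_shift s l X : shifts s (shift l X) = shift l (shifts s X).
Proof. by elim: s X => [//|m s ih] X /=; rewrite -ih shiftC. Qed.

Let shifts_cvg0 s X : S X -> shifts s X = 0 ->
  forall i j, vanishes (fun t => semigroup G t X i j).
Proof.
elim: s X => [|l s ih] X SX /= sX i j.
  rewrite sX /vanishes -(scale0r 0).
  under eq_fun => t do rewrite semigroupZ scale0r mxE ComplexField.Normc.normc0.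
  exact: cvg_cst.
have [l0|l0] := ltP (complex.Re l) 0; last first.
  apply: ih => //; apply: (S_eigen (lam := l)) => //; first exact: S_shifts.
  by apply/eqP; rewrite -subr_eq0 -/(shift _ _) -shifts_shift sX.
(* Here [Re l < 0]: an entry of the trajectory solves z' = l z + w, where [w] comes from [shift l X]
   and vanishes by induction. Repeated roots need no separate treatment. *)
have w0 := ih _ (S_lin l (S_inv SX) SX) sX i j.
apply: (forced_decay l0 _ w0) => p t.
have -> : l * semigroup G t X i j + semigroup G t (shift l X) i j =
          semigroup G t (G X) i j.
  have entry (A B : 'M[C]_n) : (A - l *: B) i j = A i j - l * B i j.
    by rewrite !mxE.
  by rewrite /shift semigroupD -scaleNr semigroupZ scaleNr entry addrC subrK.
exact: is_derive_semigroup.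
Qed.

(* By Cayley-Hamilton, X is killed by a product of factors G - lam; these are
   stripped one at a time, a factor with Re lam >= 0 being injective on S. *)
Theorem semigroup_vanishes X : S X ->
  forall i j, vanishes (fun t => semigroup G t X i j).
Proof.
move=> SX; have [s sX] : exists s, shifts s X = 0; last exact: shifts_cvg0 sX.
have shiftE l Y : mxvec (shift l Y) = mxvec Y *m (lin_mx G - l%:M).
  by rewrite /shift mulmxBr mul_vec_lin linearB linearZ mul_mx_scalar.
(* Cayley-Hamilton is applied in positive dimension, so [n * n] is replaced by a variable that can
   be split; [A] and [v] then retain only the properties of [lin_mx G] and [mxvec] that were
   stated. *)
have [N NE] : exists N, (n * n = N)%N by exists (n * n)%N.
have v0 : mxvec (0 : 'M[C]_n) = 0 by exact: linear0.
have v_inj : injective (fun X : 'M[C]_n => mxvec X) := can_inj mxvecK.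
move: (lin_mx G) (@mxvec C n n) v_inj shiftE v0; rewrite NE.
case: N {NE} => [|N] A v v_inj shiftE v0.
  by exists [::]; apply: v_inj; rewrite (thinmx0 (v _)) (thinmx0 (v 0)).
have [s ps] := closed_field_poly_normal (char_poly A).
exists s; apply: v_inj.
have shiftsE Y : v (shifts s Y) = v Y *m \prod_(l <- s) (A - l%:M).
  elim: s Y {ps} => [|l s ih] Y; first by rewrite big_nil mulmx1.
  by rewrite big_cons /= ih shiftE -mulmxA.
rewrite shiftsE v0.
have := Cayley_Hamilton A; rewrite ps (monicP (char_poly_monic A)) scale1r.
rewrite rmorph_prod; under eq_bigr => l _ do
  rewrite rmorphB /= horner_mx_X horner_mx_C.
by move=> ->; rewrite mulmx0.
Qed.

End StableSubspace.

(** * Lindblad generators *)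

Section TraceExpansions.
Context {K : comNzRingType} {n : nat}.
Implicit Types (A H X Y L U V : 'M[K]_n) (u v : K).

Lemma mxtraceB A Y : \tr (A - Y) = \tr A - \tr Y.
Proof. exact: raddfB. Qed.

Lemma mxtraceN A : \tr (- A) = - \tr A.
Proof. exact: raddfN. Qed.

Lemma linear_comb_linear u v (a1 a2 a3 a4 a5 b1 b2 b3 b4 b5 : 'M[K]_n) a :
  - (u *: ((a *: a1 + b1) - (a *: a2 + b2))) + (a *: a3 + b3)
    - v *: ((a *: a4 + b4) + (a *: a5 + b5)) =
  a *: (- (u *: (a1 - a2)) + a3 - v *: (a4 + a5)) +
  (- (u *: (b1 - b2)) + b3 - v *: (b4 + b5)).
Proof. by apply/matrixP => i j; rewrite !mxE; ring. Qed.

(** In this and the next two lemmas [A], [Y] and [V] stand for the adjoints of [L], [X] and [U];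
    with adjunction forgotten, only ring identities and cyclicity of the trace remain. *)
Lemma mxtrace_pairing u v X Y H L A :
  \tr (Y *m (- (u *: (H *m X - X *m H)) + L *m X *m A
    - v *: (A *m L *m X + X *m (A *m L)))) =
  - (u * (\tr (Y *m H *m X) - \tr (Y *m X *m H))) + \tr (Y *m L *m X *m A)
    - v * (\tr (Y *m A *m L *m X) + \tr (Y *m X *m A *m L)).
Proof.
rewrite mulmxBr mulmxDr mulmxN mxtraceB mxtraceD mxtraceN.
rewrite -!scalemxAr !mxtraceZ mulmxBr mulmxDr mxtraceB mxtraceD.
by rewrite !mulmxA.
Qed.

(** Two of the four terms are cyclically rotated; the normality hypothesis [LA] serves to reorder
    [L] and [A] in the last one. *)
Lemma mxtrace_commutators X Y L A : L *m A = A *m L ->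
  \tr ((Y *m A - A *m Y) *m (L *m X - X *m L)) =
  \tr (Y *m A *m L *m X) - \tr (Y *m A *m X *m L) - \tr (Y *m L *m X *m A) +
  \tr (Y *m X *m A *m L).
Proof.
move=> LA.
have e1 : \tr (A *m Y *m L *m X) = \tr (Y *m L *m X *m A).
  by rewrite [RHS]mxtrace_mulC !mulmxA.
have e2 : \tr (A *m Y *m X *m L) = \tr (Y *m X *m A *m L).
  by rewrite -(mulmxA (Y *m X)) -LA mulmxA [RHS]mxtrace_mulC !mulmxA.
rewrite mulmxBl !mulmxBr !mxtraceB !mulmxA e1 e2.
by rewrite opprB addrA -!addrA; congr (_ + (_ + _)); rewrite addrC.
Qed.

Lemma conj_comb u v U V H L A X : V *m U = 1%:M ->
  - (u *: ((U *m H *m V) *m (U *m X *m V) - (U *m X *m V) *m (U *m H *m V)))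
    + (U *m L *m V) *m (U *m X *m V) *m (U *m A *m V)
    - v *: ((U *m A *m V) *m (U *m L *m V) *m (U *m X *m V) +
            (U *m X *m V) *m ((U *m A *m V) *m (U *m L *m V))) =
  U *m (- (u *: (H *m X - X *m H)) + L *m X *m A
    - v *: (A *m L *m X + X *m (A *m L))) *m V.
Proof.
move=> VU.
have cM Y Z : (U *m Y *m V) *m (U *m Z *m V) = U *m (Y *m Z) *m V.
  by rewrite !mulmxA -[_ *m V *m U]mulmxA VU mulmx1.
rewrite !cM; pose f Y := U *m Y *m V; rewrite -![U *m _ *m V]/(f _).
have fB Y Z : f (Y - Z) = f Y - f Z by rewrite /f mulmxBr mulmxBl.
have fD Y Z : f (Y + Z) = f Y + f Z by rewrite /f mulmxDr mulmxDl.
have fZ c Y : f (c *: Y) = c *: f Y by rewrite /f -scalemxAr -scalemxAl.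
have fN Y : f (- Y) = - f Y by rewrite /f mulmxN mulNmx.
by rewrite fB fD fN !fZ fB fD.
Qed.

End TraceExpansions.

(** Equal blocks [l] make the dissipator act on each block separately. The two Hamiltonian blocks
    meet only off the diagonal, where h0 B - B h1 = [h0, B] + B (h0 - h1), and dually for [D]. *)
Lemma block_comb (K : comNzRingType) p (u v : K) (h0 h1 l a A B D E : 'M[K]_p) :
  - (u *: (block_mx h0 0 0 h1 *m block_mx A B D E -
           block_mx A B D E *m block_mx h0 0 0 h1))
  + block_mx l 0 0 l *m block_mx A B D E *m block_mx a 0 0 a
  - v *: (block_mx a 0 0 a *m block_mx l 0 0 l *m block_mx A B D E +
          block_mx A B D E *m (block_mx a 0 0 a *m block_mx l 0 0 l)) =
  let g h Y := - (u *: (h *m Y - Y *m h)) + l *m Y *m a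
    - v *: (a *m l *m Y + Y *m (a *m l)) in
  block_mx (g h0 A) (g h0 B - u *: (B *m (h0 - h1)))
    (g h0 D + u *: ((h0 - h1) *m D)) (g h1 E).
Proof.
rewrite /= !mulmx_block !(mul0mx, mulmx0, addr0, add0r).
rewrite !(opp_block_mx, add_block_mx, scale_block_mx) mulmxBr mulmxBl.
congr block_mx.
  by apply/matrixP => i j; rewrite !mxE; ring.
by apply/matrixP => i j; rewrite !mxE; ring.
Qed.

(** Arithmetic of twice a real part, with [d] the conjugate of [c]: the Hamiltonian term is
    imaginary and cancels, and the dissipative terms assemble into the expansion of the squared
    commutator norm. *)
Lemma energy_balance (K : numFieldType) (u a b c d e f : K) :
  - (u * (a - b)) + c - 2^-1 * (e + f) + (- (- u * (a - b)) + d - 2^-1 * (e + f)) =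
  - (e - d - c + f).
Proof. by field. Qed.

Section Lindblad.
Context {R : realType}.
Local Notation C := R[i].
Local Notation normc := ComplexField.Normc.normc.

Lemma adjmxM p q r (A : 'M[C]_(p, q)) (B : 'M[C]_(q, r)) :
  (A *m B) ^t* = B ^t* *m A ^t*.
Proof. by rewrite trmx_mul map_mxM. Qed.

Lemma adjmxK p q (A : 'M[C]_(p, q)) : (A ^t*) ^t* = A.
Proof. by apply/matrixP => i j; rewrite !mxE conjCK. Qed.

Lemma adjmxB p q (A B : 'M[C]_(p, q)) : (A - B) ^t* = A ^t* - B ^t*.
Proof. by rewrite linearB map_mxB. Qed.

Lemma adjmx_block p q r s (A : 'M[C]_(p, r)) (B : 'M[C]_(p, s))
    (D : 'M[C]_(q, r)) (E : 'M[C]_(q, s)) :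
  (block_mx A B D E) ^t* = block_mx (A ^t*) (D ^t*) (B ^t*) (E ^t*).
Proof. by rewrite tr_block_mx map_block_mx. Qed.

Lemma adjmx0 p q : (0 : 'M[C]_(p, q)) ^t* = 0.
Proof. by rewrite trmx0 map_mx0. Qed.

Lemma mxtrace_adj n (A : 'M[C]_n) : \tr (A ^t*) = Num.conj (\tr A).
Proof.
by rewrite /mxtrace rmorph_sum; apply: eq_bigr => i _; rewrite !mxE.
Qed.

Lemma mxtrace_adjM n (A : 'M[C]_n) :
  \tr (A ^t* *m A) = \sum_i \sum_j `|A i j| ^+ 2.
Proof.
rewrite exchange_big; apply: eq_bigr => i _; rewrite mxE.
by apply: eq_bigr => j _; rewrite !mxE normCK mulrC.
Qed.

Lemma mxtrace_adjM_ge0 n (A : 'M[C]_n) : 0 <= \tr (A ^t* *m A).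
Proof.
by rewrite mxtrace_adjM; do 2![apply: sumr_ge0 => ? _]; rewrite exprn_ge0.
Qed.

Lemma mxtrace_adjM_eq0 n (A : 'M[C]_n) : \tr (A ^t* *m A) = 0 -> A = 0.
Proof.
rewrite mxtrace_adjM => /eqP; rewrite psumr_eq0 => [/allP h|i _]; last first.
  by apply: sumr_ge0 => ? _; rewrite exprn_ge0.
apply/matrixP => i j; rewrite mxE.
have := h i (mem_index_enum i); rewrite psumr_eq0 => [/allP h'|? _]; last first.
  by rewrite exprn_ge0.
have := h' j (mem_index_enum j); rewrite /= expf_eq0 /= normr_eq0.
by move/eqP.
Qed.

Section Generator.
Context {n : nat}.
Implicit Types H L X U : 'M[C]_n.

Lemma lindblad_is_linear H L : linear (lindblad H L).
Proof.
move=> a X Y; rewrite /lindblad /commutator /anticommutator.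
rewrite -linear_comb_linear.
by rewrite !mulmxDr !mulmxDl -!scalemxAr -!scalemxAl.
Qed.

HB.instance Definition _ H L :=
  GRing.isLinear.Build C 'M[C]_n 'M[C]_n _ (lindblad H L) (lindblad_is_linear H L).

(** Trace preservation will make the matrices with traceless blocks an invariant subspace. *)
Lemma mxtrace_lindblad H L X : \tr (lindblad H L X) = 0.
Proof.
rewrite /lindblad /commutator /anticommutator.
rewrite mxtraceB mxtraceD mxtraceN !mxtraceZ mxtraceB mxtraceD.
rewrite (mxtrace_mulC X H) subrr mulr0 oppr0 add0r.
rewrite (mxtrace_mulC X) (mxtrace_mulC _ (L ^t*)) mulmxA.
by set z := \tr _; field.
Qed.

(** All three dissipative products become [X *m (L ^t* *m L)], and the weights 1, -1/2, -1/2
    cancel. *)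
Lemma lindblad_commute H L X : L *m L ^t* = L ^t* *m L ->
  L *m X = X *m L -> L ^t* *m X = X *m L ^t* ->
  lindblad H L X = - ('i%C *: commutator H X).
Proof.
move=> nL LX L'X; rewrite /lindblad /anticommutator.
have -> : L *m X *m L ^t* = X *m (L ^t* *m L) by rewrite LX -mulmxA nL.
have -> : L ^t* *m L *m X = X *m (L ^t* *m L).
  by rewrite -mulmxA LX mulmxA L'X mulmxA.
rewrite -addrA (_ : _ - _ = 0) ?addr0 //.
by move: (X *m _) => Z; apply/matrixP => i j; rewrite !mxE; field.
Qed.

Lemma lindblad_energy H L X : H ^t* = H -> L *m L ^t* = L ^t* *m L ->
  \tr (X ^t* *m lindblad H L X) + Num.conj (\tr (X ^t* *m lindblad H L X)) =
  - \tr ((commutator L X) ^t* *m commutator L X).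
Proof.
move=> hH nL.
pose h1 := \tr (X ^t* *m H *m X); pose h2 := \tr (X ^t* *m X *m H).
pose T1 := \tr (X ^t* *m L *m X *m L ^t*).
pose T2 := \tr (X ^t* *m L ^t* *m L *m X).
pose T3 := \tr (X ^t* *m X *m L ^t* *m L).
have ch1 : Num.conj h1 = h1 by rewrite -mxtrace_adj !adjmxM adjmxK hH mulmxA.
have ch2 : Num.conj h2 = h2.
  by rewrite -mxtrace_adj !adjmxM adjmxK hH mxtrace_mulC.
have cT2 : Num.conj T2 = T2 by rewrite -mxtrace_adj !adjmxM !adjmxK !mulmxA.
have cT3 : Num.conj T3 = T3.
  by rewrite -mxtrace_adj !adjmxM !adjmxK mulmxA mxtrace_mulC !mulmxA.
have cT1 : Num.conj T1 = \tr (X ^t* *m L ^t* *m X *m L).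
  rewrite -mxtrace_adj !adjmxM !adjmxK mxtrace_mulC.
  by rewrite -!mulmxA mxtrace_mulC !mulmxA.
have -> : \tr (X ^t* *m lindblad H L X) =
    - ('i%C * (h1 - h2)) + T1 - 2^-1 * (T2 + T3).
  exact: mxtrace_pairing.
have -> : \tr ((commutator L X) ^t* *m commutator L X) = T2 - Num.conj T1 - T1 + T3.
  rewrite cT1 /commutator adjmxB !adjmxM; exact: mxtrace_commutators.
have ci : Num.conj 'i%C = - 'i%C :> C by apply/eqP; rewrite eq_complex /= oppr0 !eqxx.
rewrite !rmorphD !rmorphN !rmorphM !rmorphD rmorphN /= ch1 ch2 cT2 cT3 ci.
rewrite fmorphV rmorph_nat; exact: energy_balance.
Qed.

(* The energy of an eigenvector X is (2 Re lam) |X|^2 = - |[L, X]|^2. *)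
Lemma lindblad_eigen_commute H L X lam : H ^t* = H -> L *m L ^t* = L ^t* *m L ->
  lindblad H L X = lam *: X -> 0 <= complex.Re lam -> L *m X = X *m L.
Proof.
move=> hH nL GX lam0; have := lindblad_energy X hH nL.
have cN : Num.conj (\tr (X ^t* *m X)) = \tr (X ^t* *m X).
  by rewrite -mxtrace_adj adjmxM adjmxK.
rewrite GX -scalemxAr mxtraceZ rmorphM /= cN.
have lam2 : lam + Num.conj lam = (2 * complex.Re lam)%:C.
  by case: lam {GX lam0} => x y; apply/eqP; rewrite eq_complex /= subrr; apply/andP; split; apply/eqP => //; ring.
rewrite -mulrDl lam2 => e.
have l2 : 0 <= (2 * complex.Re lam)%:C :> C by rewrite ler0c mulr_ge0.
have := mulr_ge0 l2 (mxtrace_adjM_ge0 X); rewrite e oppr_ge0 => N0.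
have /mxtrace_adjM_eq0/eqP : \tr ((commutator L X)^t* *m commutator L X) = 0.
  by apply/eqP; rewrite eq_le N0 mxtrace_adjM_ge0.
by rewrite subr_eq0 => /eqP.
Qed.

Lemma lindblad_unitary U H L X : U ^t* *m U = 1%:M ->
  lindblad (U *m H *m U ^t*) (U *m L *m U ^t*) (U *m X *m U ^t*) =
  U *m lindblad H L X *m U ^t*.
Proof.
move=> uU; rewrite /lindblad /commutator /anticommutator.
rewrite (_ : (U *m L *m U ^t*) ^t* = U *m L ^t* *m U ^t*).
  exact: conj_comb.
by rewrite !adjmxM adjmxK mulmxA.
Qed.

End Generator.

Lemma lindblad_block p (h0 h1 l A B D E : 'M[C]_p) :
  lindblad (block_mx h0 0 0 h1) (block_mx l 0 0 l) (block_mx A B D E) =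
  block_mx (lindblad h0 l A) (lindblad h0 l B - 'i%C *: (B *m (h0 - h1)))
    (lindblad h0 l D + 'i%C *: ((h0 - h1) *m D)) (lindblad h1 l E).
Proof.
rewrite /lindblad /commutator /anticommutator adjmx_block !adjmx0.
exact: block_comb.
Qed.
End Lindblad.

(** * Two copies of a generator with scalar attractors *)

Section TwoCopies.
Context {R : realType}.
Local Notation C := R[i].
Local Notation normc := ComplexField.Normc.normc.

Lemma hs_norm_cvg0 n (M : R -> 'M[C]_n) :
  hs_norm (M t) @[t --> +oo] --> (0 : R) <->
  forall i j, vanishes (fun t => M t i j).
Proof.
split=> [M0 i j|M0].
  apply: (@vanishes_le _ _ (fun t => hs_norm (M t))) => // t.
  rewrite -[leLHS]ger0_norm ?normc_ge0 // -sqrtr_sqr ler_wsqrtr //.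
  rewrite (bigD1 i) //= (bigD1 j) //= -addrA lerDl addr_ge0 //.
    by apply: sumr_ge0 => *; exact: sqr_ge0.
  by apply: sumr_ge0 => *; apply: sumr_ge0 => *; exact: sqr_ge0.
rewrite -sqrtr0; apply: continuous_cvg; first exact: sqrt_continuous.
have sum0 (I : finType) (F : I -> R -> R) :
    (forall i, F i t @[t --> +oo] --> 0) ->
    \sum_i F i t @[t --> +oo] --> 0.
  move=> F0; suff : \sum_i F i t @[t --> +oo] --> \sum_(i : I) (0 : R).
    by rewrite [X in _ --> X]big1.
  by apply: cvg_big => //; exact: add_continuous.
apply: (sum0) => i; apply: (sum0) => j.
have Mij : normc (M t i j) @[t --> +oo] --> 0 := M0 i j.
have := cvgM Mij Mij; rewrite mulr0.
have -> : (fun t => normc (M t i j) ^+ 2) =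
    (fun t => normc (M t i j)) \* (fun t => normc (M t i j)).
  by apply/funext => t; rewrite expr2.
by apply.
Qed.

Variables (p : nat) (U : 'M[C]_(p + p)).

(** The scalars are the energies of the first virtual factor; inside a block they commute with
    everything, so only [e0 - e1] is felt, off the diagonal. *)
Definition copies_hamiltonian (h : 'M[C]_p) (e0 e1 : R) : 'M[C]_(p + p) :=
  U *m block_mx (h + e0%:C%:M) 0 0 (h + e1%:C%:M) *m U ^t*.

Definition copies_op (l : 'M[C]_p) : 'M[C]_(p + p) :=
  U *m block_mx l 0 0 l *m U ^t*.

(** In the frame this is the 2x2 matrix (a, b; c, d) tensored with the identity. *)
Definition steady (a b c d : C) : 'M[C]_(p + p) :=
  U *m block_mx a%:M b%:M c%:M d%:M *m U ^t*.

Definition frame (X : 'M[C]_(p + p)) : 'M[C]_(p + p) := U ^t* *m X *m U.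

(** In the frame: the partial trace over the second factor, tensored with the maximally mixed
    state. *)
Definition steady_part (X : 'M[C]_(p + p)) : 'M[C]_(p + p) :=
  let M := frame X in
  steady (\tr (ulsubmx M) / p%:R) (\tr (ursubmx M) / p%:R)
         (\tr (dlsubmx M) / p%:R) (\tr (drsubmx M) / p%:R).

Variables (h l : 'M[C]_p) (e0 e1 : R).
Hypothesis p_gt0 : (0 < p)%N.
Hypothesis uU : U ^t* *m U = 1%:M.
Hypothesis normal_l : l *m l ^t* = l ^t* *m l.
Hypothesis eigen_scalar : forall A lam, lindblad h l A = lam *: A ->
  0 <= complex.Re lam -> exists a, A = a%:M.

Let G := lindblad (copies_hamiltonian h e0 e1) (copies_op l).
Let g := lindblad h l.
Let dE := e0 - e1.
Let p0 : p%:R != 0 :> C.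
Proof. by rewrite pnatr_eq0 -lt0n. Qed.

Lemma unframe M : frame (U *m M *m U ^t*) = M.
Proof. by rewrite /frame !mulmxA uU mul1mx -mulmxA uU mulmx1. Qed.

Let frameK X : U *m frame X *m U ^t* = X.
Proof.
have uU' : U *m U ^t* = 1%:M by exact: mulmx1C.
by rewrite /frame !mulmxA uU' mul1mx -mulmxA uU' mulmx1.
Qed.

Let frame_lin a X Y : frame (X - a *: Y) = frame X - a *: frame Y.
Proof. by rewrite /frame mulmxBr mulmxBl -scalemxAr -scalemxAl. Qed.

Lemma frame_lindblad X : frame (G X) =
  let M := frame X in
  block_mx (g (ulsubmx M)) (g (ursubmx M) - ('i%C * dE%:C) *: ursubmx M)
    (g (dlsubmx M) + ('i%C * dE%:C) *: dlsubmx M) (g (drsubmx M)).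
Proof.
rewrite -{1}(frameK X) /G /copies_hamiltonian /copies_op lindblad_unitary //.
rewrite unframe /= -{1}(submxK (frame X)) lindblad_block.
have gs e A : lindblad (h + e%:M) l A = g A.
  rewrite /g /lindblad /commutator mulmxDl mulmxDr mul_scalar_mx mul_mx_scalar.
  by rewrite opprD addrACA subrr addr0.
rewrite opprD addrACA subrr add0r -raddfB -rmorphB /= !gs.
by rewrite mul_scalar_mx mul_mx_scalar !scalerA.
Qed.

Let scalar0 : 0%:M = 0 :> 'M[C]_p.
Proof. by apply/matrixP => i j; rewrite !mxE mul0rn. Qed.

Let steady0 : steady 0 0 0 0 = 0.
Proof. by rewrite /steady scalar0 block_mx0 mulmx0 mul0mx. Qed.

Let g_scalar a : g a%:M = 0.
Proof.
rewrite /g lindblad_commute ?scalar_mxC //.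
by rewrite /commutator scalar_mxC subrr scaler0 oppr0.
Qed.

Let frame_steady a b c d : frame (steady a b c d) = block_mx a%:M b%:M c%:M d%:M.
Proof. exact: unframe. Qed.

Lemma lindblad_steady a b c d :
  G (steady a b c d) = steady 0 (- ('i%C * dE%:C) * b) ('i%C * dE%:C * c) 0.
Proof.
rewrite -[LHS]frameK frame_lindblad frame_steady /=.
rewrite block_mxKul block_mxKur block_mxKdl block_mxKdr !g_scalar.
by rewrite sub0r add0r -scaleNr !scale_scalar_mx /steady scalar0.
Qed.

Lemma steadyD a b c d a' b' c' d' :
  steady a b c d + steady a' b' c' d' =
  steady (a + a') (b + b') (c + c') (d + d').
Proof. by rewrite /steady -mulmxDl -mulmxDr add_block_mx -!raddfD. Qed.

Lemma steadyZ u a b c d :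
  u *: steady a b c d = steady (u * a) (u * b) (u * c) (u * d).
Proof.
by rewrite /steady scalemxAl scalemxAr scale_block_mx !scale_scalar_mx.
Qed.

Let steady_split a b c d :
  steady a b c d = steady a 0 0 d + (steady 0 b 0 0 + steady 0 0 c 0).
Proof. by rewrite !steadyD !(addr0, add0r). Qed.

Let eigen_diag a d : G (steady a 0 0 d) = ((0 : R)%:C * 'i%C) *: steady a 0 0 d.
Proof. by rewrite lindblad_steady mul0r steadyZ !mulr0 !mul0r. Qed.

Let eigen_up b : G (steady 0 b 0 0) = ((- dE)%:C * 'i%C) *: steady 0 b 0 0.
Proof.
rewrite lindblad_steady (_ : (- dE)%:C * 'i%C = - ('i%C * dE%:C)).
  by rewrite steadyZ !mulr0.
by rewrite rmorphN mulNr mulrC.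
Qed.

Let eigen_dn c : G (steady 0 0 c 0) = (dE%:C * 'i%C) *: steady 0 0 c 0.
Proof. by rewrite lindblad_steady steadyZ !mulr0 [dE%:C * 'i%C]mulrC. Qed.

Lemma semigroup_steady t a b c d :
  semigroup G t (steady a b c d) =
  steady a (cis (- dE * t) * b) (cis (dE * t) * c) d.
Proof.
rewrite steady_split /G !semigroupD.
rewrite (semigroup_eigen _ (eigen_diag a d)) (semigroup_eigen _ (eigen_up b)).
rewrite (semigroup_eigen _ (eigen_dn c)) !steadyZ !steadyD !mulr0.
have -> : cis (0 * t) = 1 by rewrite mul0r /cis cos0 sin0.
by rewrite !(addr0, add0r) !mul1r.
Qed.

Lemma steady_attractor a b c d : attractor_space G (steady a b c d).
Proof.
exists 3%N, (fun k => nth 0 [:: 0; - dE; dE] k).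
exists (fun k => nth 0 [:: steady a 0 0 d; steady 0 b 0 0; steady 0 0 c 0] k).
split=> [[[|[|[|//]]] ?] /=|]; [exact: eigen_diag|exact: eigen_up|exact: eigen_dn|].
by rewrite !big_ord_recl big_ord0 /= addr0 -steady_split.
Qed.

Let trace_scalar a : \tr (a%:M : 'M[C]_p) = a * p%:R.
Proof. by rewrite mxtrace_scalar mulr_natr. Qed.

(** Every block of an eigenvector is an eigenvector of [g]; off the diagonal the eigenvalue is
    shifted by the imaginary number [i dE] or its opposite, which leaves the sign condition on the
    real part intact. *)
Let eigen_blocks X lam : G X = lam *: X -> 0 <= complex.Re lam ->
  exists a b c d, X = steady a b c d.
Proof.
move=> GX lam0; set M := frame X.
have /eqP : frame (G X) = lam *: frame X.
  by rewrite GX /frame -scalemxAr -scalemxAl.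
rewrite frame_lindblad /= -/M -[in eqbRHS](submxK M) scale_block_mx => /eqP.
move=> /eq_block_mx [e1' e2' e3' e4'].
have Rei : complex.Re ('i%C * dE%:C) = 0 by rewrite /= ?(mul0r, mulr0, subr0, subrr).
have [a aE] := eigen_scalar e1' lam0.
have [d dE'] := eigen_scalar e4' lam0.
have [b bE] : exists b, ursubmx M = b%:M.
  apply: (@eigen_scalar _ (lam + 'i%C * dE%:C)).
    by rewrite scalerDl -e2' subrK.
  have -> : complex.Re (lam + 'i%C * dE%:C) = complex.Re lam + complex.Re ('i%C * dE%:C).
    exact: (cpartD false).
  by rewrite Rei addr0.
have [c cE] : exists c, dlsubmx M = c%:M.
  apply: (@eigen_scalar _ (lam - 'i%C * dE%:C)).
    by rewrite scalerBl -e3' addrK.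
  have -> : complex.Re (lam - 'i%C * dE%:C) = complex.Re lam - complex.Re ('i%C * dE%:C).
    by case: (lam) => x y.
  by rewrite Rei subr0.
exists a, b, c, d.
by rewrite /steady -aE -bE -cE -dE' submxK frameK.
Qed.

Let sub_lin a (A B : 'M[C]_(p + p)) :
  [/\ ulsubmx (A - a *: B) = ulsubmx A - a *: ulsubmx B,
      ursubmx (A - a *: B) = ursubmx A - a *: ursubmx B,
      dlsubmx (A - a *: B) = dlsubmx A - a *: dlsubmx B &
      drsubmx (A - a *: B) = drsubmx A - a *: drsubmx B].
Proof. by split; apply/matrixP => i j; rewrite !mxE. Qed.

Let trace_lin0 a (A B : 'M[C]_p) :
  \tr A = 0 -> \tr B = 0 -> \tr (A - a *: B) = 0.
Proof. by move=> A0 B0; rewrite mxtraceB mxtraceZ A0 B0 mulr0 subr0. Qed.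

Let trace_scalar0 a : \tr (a%:M : 'M[C]_p) = 0 -> a = 0.
Proof.
by rewrite trace_scalar => /eqP; rewrite mulf_eq0 (negPf p0) orbF => /eqP.
Qed.

Let trace_centered (A : 'M[C]_p) : \tr (A - 1 *: (\tr A / p%:R)%:M) = 0.
Proof. by rewrite scale1r mxtraceB trace_scalar divfK // subrr. Qed.

(** The kernel of [steady_part], a complement of the steady matrices: a scalar block of trace zero
    is zero, so no attractor other than zero lies in it. *)
Let traceless X : Prop :=
  let M := frame X in [/\ \tr (ulsubmx M) = 0, \tr (ursubmx M) = 0,
    \tr (dlsubmx M) = 0 & \tr (drsubmx M) = 0].

Let traceless_vanishes X : traceless X ->
  forall i j, vanishes (fun t => semigroup G t X i j).
Proof.
apply: (@semigroup_vanishes _ _ G traceless).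
- move=> a Y Z [y1 y2 y3 y4] [z1 z2 z3 z4]; rewrite /traceless frame_lin.
  have [-> -> -> ->] := sub_lin a (frame Y) (frame Z).
  by split; apply: trace_lin0.
- move=> Y [y1 y2 y3 y4]; rewrite /traceless frame_lindblad /=.
  rewrite block_mxKul block_mxKur block_mxKdl block_mxKdr.
  split; [exact: mxtrace_lindblad| | |exact: mxtrace_lindblad].
    by apply: trace_lin0 => //; exact: mxtrace_lindblad.
  rewrite -['i%C * _]opprK scaleNr.
  by apply: trace_lin0 => //; exact: mxtrace_lindblad.
- move=> Y lam tY GY lam0; have [a [b [c [d YE]]]] := eigen_blocks GY lam0.
  move: tY; rewrite YE /traceless frame_steady /=.
  rewrite block_mxKul block_mxKur block_mxKdl block_mxKdr.
  case=> /trace_scalar0 -> /trace_scalar0 -> /trace_scalar0 -> /trace_scalar0 ->.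
  exact: steady0.
Qed.

Lemma steady_partP X i j :
  vanishes (fun t => semigroup G t (X - steady_part X) i j).
Proof.
apply: traceless_vanishes; rewrite /traceless.
rewrite -(scale1r (steady_part X)) frame_lin.
have [-> -> -> ->] := sub_lin 1 (frame X) (frame (steady_part X)).
rewrite frame_steady block_mxKul block_mxKur block_mxKdl block_mxKdr.
by split; exact: trace_centered.
Qed.

(** Along a steady trajectory the frame entries have constant modulus, so they tend to zero only if
    they are zero. This gives uniqueness of the asymptotic state. *)
Let steady_vanishes0 a b c d :
  (forall i j, vanishes (fun t => semigroup G t (steady a b c d) i j)) ->
  [/\ a = 0, b = 0, c = 0 & d = 0].
Proof.
move=> v.
have fv i j : vanishes (fun t => frame (semigroup G t (steady a b c d)) i j).
  rewrite /frame.
  under [X in vanishes X]eq_fun => t do rewrite mxE.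
  apply: vanishes_sum => k.
  under [X in vanishes X]eq_fun => t do rewrite mulrC mxE.
  apply: vanishesZ; apply: vanishes_sum => k'; exact: vanishesZ.
have cst0 (z w : R -> C) (x : C) : z = w -> (forall t, normc (w t) = normc x) ->
    vanishes z -> x = 0.
  move=> -> wx; rewrite /vanishes; under eq_fun => t do rewrite wx.
  move=> /cvg_lim h0; apply: ComplexField.Normc.eq0_normc.
  by rewrite -h0 // lim_cst.
pose o := Ordinal p_gt0.
have fr t : frame (semigroup G t (steady a b c d)) =
    block_mx a%:M (cis (- dE * t) * b)%:M (cis (dE * t) * c)%:M d%:M.
  by rewrite semigroup_steady frame_steady.
split.
- apply: (cst0 _ (fun=> a) _ _ _ (fv (lshift p o) (lshift p o))) => //.
  by apply/funext => t; rewrite fr block_mxEul mxE eqxx mulr1n.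
- apply: (cst0 _ (fun t => cis (- dE * t) * b) _ _ _ (fv (lshift p o) (rshift p o))).
    by apply/funext => t; rewrite fr block_mxEur mxE eqxx mulr1n.
  by move=> t; rewrite ComplexField.Normc.normcM normc_cis mul1r.
- apply: (cst0 _ (fun t => cis (dE * t) * c) _ _ _ (fv (rshift p o) (lshift p o))).
    by apply/funext => t; rewrite fr block_mxEdl mxE eqxx mulr1n.
  by move=> t; rewrite ComplexField.Normc.normcM normc_cis mul1r.
- apply: (cst0 _ (fun=> d) _ _ _ (fv (rshift p o) (rshift p o))) => //.
  by apply/funext => t; rewrite fr block_mxEdr mxE eqxx mulr1n.
Qed.

Theorem asymptotic_startP rho X :
  asymptotic_start G rho X <-> X = steady_part rho.
Proof.
have cv Y : hs_norm (semigroup G t rho - semigroup G t Y) @[t --> +oo] --> (0 : R)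
    <-> forall i j, vanishes (fun t => semigroup G t (rho - Y) i j).
  have e t : semigroup G t rho - semigroup G t Y = semigroup G t (rho - Y).
    by rewrite -[- Y]scaleN1r semigroupD semigroupZ scaleN1r.
  by under eq_fun => t do rewrite e; exact: hs_norm_cvg0.
split=> [[attr /cv vX]|->]; last first.
  split=> [t _|]; first by rewrite semigroup_steady; exact: steady_attractor.
  by apply/cv; exact: steady_partP.
have [a [b [c [d XE]]]] : exists a b c d, X = steady a b c d.
  (* Membership at time 0 puts [X] itself in the attractor space, where each eigenvalue has real
     part zero. *)
  have := attr 0 (lexx 0); rewrite semigroup0 => -[q [w [Y [GY ->]]]].
  elim/big_ind: _ => [|Z Z' [a [b [c [d ->]]]] [a' [b' [c' [d' ->]]]]|k _].
  - by exists 0, 0, 0, 0; rewrite steady0.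
  - by exists (a + a'), (b + b'), (c + c'), (d + d'); rewrite steadyD.
  - by apply: (eigen_blocks (GY k)); rewrite /= mulr0 mul0r subrr.
(* The difference is [(rho - X) - (rho - steady_part rho)], and both trajectories vanish. *)
have vd i j : vanishes (fun t => semigroup G t (steady_part rho - X) i j).
  have -> : (fun t => semigroup G t (steady_part rho - X) i j) =
    (fun t => semigroup G t (rho - X) i j +
              (-1) * semigroup G t (rho - steady_part rho) i j).
    apply/funext => t; have entry (A B : 'M[C]_(p + p)) u :
      (A + u *: B) i j = A i j + u * B i j by rewrite !mxE.
    rewrite -entry -semigroupZ -semigroupD; congr (semigroup G t _ i j).
    by rewrite scaleN1r opprB [RHS]addrC addrA subrK.
  by apply: vanishesD => //; apply: vanishesZ; exact: steady_partP.
apply/esym/eqP; rewrite -subr_eq0; apply/eqP.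
move: vd; rewrite XE /steady_part -[- steady _ _ _ _]scaleN1r steadyZ steadyD.
move=> /steady_vanishes0 [-> -> -> ->].
exact: steady0.
Qed.

End TwoCopies.

(** * The one-qubit generator *)

Section Qubits.
Context {R : realType}.
Local Notation C := R[i].
Local Notation normc := ComplexField.Normc.normc.

Lemma cisD (x y : R) : cis (x + y) = cis x * cis y.
Proof.
by apply/eqP; rewrite eq_complex /= cosD sinD eqxx /= addrC eqxx.
Qed.

Lemma cis0 : cis 0 = 1 :> C.
Proof. by rewrite /cis cos0 sin0. Qed.

Lemma cisN (x : R) : cis (- x) * cis x = 1.
Proof. by rewrite -cisD addNr cis0. Qed.

Lemma normc_real (x : R) : normc x%:C = `|x|.
Proof. by rewrite /= expr0n addr0 sqrtr_sqr. Qed.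

Lemma conj_cis (x : R) : Num.conj (cis x) = cis (- x).
Proof. by rewrite /cis cosN sinN. Qed.

Lemma conj_real (x : R) : Num.conj x%:C = x%:C.
Proof. exact: conjc_real. Qed.

Lemma conj_i : Num.conj 'i%C = - 'i%C :> C.
Proof. by apply/eqP; rewrite eq_complex /= oppr0 !eqxx. Qed.

Lemma polar_form (z : C) : exists mu : R, z = (normc z)%:C * cis mu.
Proof.
have [->|z0] := eqVneq z 0.
  by exists 0; rewrite ComplexField.Normc.normc0 mul0r.
have n0 : normc z != 0.
  by apply: contra_neq z0; exact: ComplexField.Normc.eq0_normc.
case: z z0 n0 => x y _ n0; set n := normc _ in n0 *.
have n2 : n ^+ 2 = x ^+ 2 + y ^+ 2 by exact: sqr_normc_ReIm.
have n2N0 : n ^+ 2 != 0 by rewrite expf_eq0.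
pose u := x / n.
have u2 : 1 - u ^+ 2 = (y / n) ^+ 2.
  rewrite !expr_div_n; apply: (mulIf n2N0); rewrite mulrBl !divfK // mul1r n2.
  by rewrite addrC addKr.
have u1 : -1 <= u <= 1.
  rewrite -ler_norml -(@ler_pXn2r _ 2) ?nnegrE // expr1n real_normK ?num_real //.
  by rewrite -subr_ge0 u2 sqr_ge0.
have sa : sin (acos u) = `|y / n| by rewrite sin_acos // u2 sqrtr_sqr.
have xu : x = n * u by rewrite /u mulrC divfK.
have yu : y = n * (y / n) by rewrite mulrC divfK.
have [yn|yn] := leP 0 (y / n).
  exists (acos u); apply/eqP; rewrite eq_complex /= !mul0r subr0 addr0.
  by rewrite acosK ?in_itv // sa ger0_norm // -xu -yu !eqxx.
exists (- acos u); apply/eqP; rewrite eq_complex /= !mul0r subr0 addr0.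
rewrite cosN sinN acosK ?in_itv // sa ltr0_norm // opprK.
by rewrite -xu -yu !eqxx.
Qed.

Definition qubit_op (a b : C) (k m : R) : 'M[C]_2 :=
  \matrix_(i, j) nth 0 (nth [::] [:: [:: a; b];
    [:: cis (2 * k) * Num.conj b; a + m%:C * cis k]] i) j.

(** With l = a + e^{ik} K and K hermitian, e^{-ik} K = e^{-2ik} (l - a). The adjoint is thus a
    polynomial in [l], which yields both normality and equality of the commutants. *)
Lemma qubit_op_adj a b k m : (qubit_op a b k m) ^t* =
  cis (- (2 * k)) *: (qubit_op a b k m - a%:M) + (Num.conj a)%:M.
Proof.
have k2 : cis (- (2 * k)) * cis k = cis (- k).
  by rewrite -cisD; congr cis; ring.
apply/matrixP => -[[|[|//]] ?] -[[|[|//]] ?]; rewrite !mxE /= ?mulr1n ?mulr0n.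
- by rewrite subrr mulr0 add0r.
- by rewrite subr0 addr0 rmorphM /= conj_cis conjCK.
- by rewrite subr0 addr0 mulrA cisN mul1r.
- rewrite rmorphD rmorphM /= conj_real conj_cis addrC; congr (_ + _).
  by rewrite addrC addKr mulrCA k2.
Qed.

Lemma qubit_op_adj_commute a b k m (A : 'M[C]_2) :
  qubit_op a b k m *m A = A *m qubit_op a b k m ->
  (qubit_op a b k m) ^t* *m A = A *m (qubit_op a b k m) ^t*.
Proof.
move=> lA; rewrite qubit_op_adj mulmxDl mulmxDr scalar_mxC; congr (_ + _).
by rewrite -scalemxAl -scalemxAr mulmxBl mulmxBr lA scalar_mxC.
Qed.

Lemma qubit_op_normal a b k m :
  qubit_op a b k m *m (qubit_op a b k m) ^t* =
  (qubit_op a b k m) ^t* *m qubit_op a b k m.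
Proof. by rewrite qubit_op_adj_commute. Qed.

Lemma H0_adj (E0 E1 : R) : (H0 E0 E1) ^t* = H0 E0 E1.
Proof.
apply/matrixP => i j; rewrite !mxE.
have [->|ij] := eqVneq i j; first by rewrite !mulr1n conj_real.
by rewrite !mulr0n rmorph0.
Qed.

(** Commuting with [l] and its adjoint removes the dissipator, so [A] is an eigenvector of
    -i[H_0, .], whose values on the two off-diagonal entries are distinct; [l] ties these entries
    together through its nonzero off-diagonal elements. *)
Lemma qubit_eigen_scalar (E0 E1 : R) a b k m (A : 'M[C]_2) lam :
  E0 - E1 != 0 -> b != 0 ->
  lindblad (H0 E0 E1) (qubit_op a b k m) A = lam *: A -> 0 <= complex.Re lam ->
  exists x, A = x%:M.
Proof.
move=> dE b0 GA lam0; have nl := qubit_op_normal a b k m.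
have lA := lindblad_eigen_commute (H0_adj E0 E1) nl GA lam0.
have l'A := qubit_op_adj_commute lA.
move: GA; rewrite lindblad_commute // => HA.
have b'0 : cis (2 * k) * Num.conj b != 0.
  rewrite mulf_neq0 ?conjC_eq0 //; apply/eqP => c0.
  by have /eqP := cisN (2 * k); rewrite c0 mulr0 eq_sym oner_eq0.
have d0 : 'i%C * (E0 - E1)%:C != 0 :> C.
  by apply/eqP => -[] /eqP; rewrite !mul0r !mul1r ?addr0 ?add0r => _ /eqP; rewrite (negPf dE).
pose o0 : 'I_2 := 0; pose o1 : 'I_2 := 1.
have /matrixP/(_ o0 o0) := lA; have /matrixP/(_ o0 o1) := lA.
have /matrixP/(_ o0 o1) := HA; have /matrixP/(_ o1 o0) := HA.
rewrite /commutator !mxE !big_ord_recl !big_ord0 !mxE /= !addr0.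
rewrite !mulr1n !mulr0n !mul0r !mulr0 !addr0 !add0r.
have -> : lift ord0 ord0 = o1 by exact: val_inj.
have -> : ord0 = o0 by exact: val_inj.
rewrite rmorphB in d0.
move=> h10 h01 l01 l00.
have e10 : 'i%C * (E0%:C - E1%:C) * A o1 o0 = lam * A o1 o0 by rewrite -h10; ring.
have e01 : - ('i%C * (E0%:C - E1%:C)) * A o0 o1 = lam * A o0 o1 by rewrite -h01; ring.
have {}l00 : b * A o1 o0 = A o0 o1 * (cis (2 * k) * Num.conj b).
  by apply: (addrI (a * A o0 o0)); rewrite l00 mulrC.
(* If this entry were nonzero, [lam] would be -i dE; the opposite entry, which asks for +i dE, would
   vanish, contradicting [l00]. *)
have A01 : A o0 o1 = 0.
  apply/eqP; apply/negPn/negP => A01.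
  have lamE := mulIf A01 e01; move: e10; rewrite -lamE => /eqP.
  rewrite -subr_eq0 -mulrBl opprK -mulr2n mulf_eq0 mulrn_eq0 (negPf d0) /=.
  move/eqP => A10; move/eqP: l00; rewrite A10 mulr0 eq_sym mulf_eq0.
  by rewrite (negPf A01) (negPf b'0).
have A10 : A o1 o0 = 0.
  by apply: (mulfI b0); rewrite l00 A01 mul0r mulr0.
have A11 : A o1 o1 = A o0 o0.
  apply: (mulfI b0); move: l01; rewrite A01 mulr0 mul0r add0r addr0 => ->.
  by rewrite mulrC.
exists (A o0 o0); apply/matrixP => i j; rewrite mxE.
have [] : (i = o0 \/ i = o1) /\ (j = o0 \/ j = o1).
  by split; [case: i|case: j] => -[|[|//]] ?; [left|right|left|right]; exact: val_inj.
by do 2![case=> ->]; rewrite ?A01 ?A10 ?A11 ?mulr1n ?mulr0n.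
Qed.

End Qubits.

(** * The decoupling frame *)

Section TwoQubitFrame.
Context {R : realType}.
Local Notation C := R[i].
Local Notation normc := ComplexField.Normc.normc.
Implicit Types phi theta : R.

Definition phase_mx (theta : R) : 'M[C]_(2 * 2) :=
  diag_mx (\row_(j < 2 * 2) nth 0 [:: 1; 1; 1; cis (2 * theta)] j).

Definition frame_mx (phi theta : R) : 'M[C]_(2 * 2) :=
  Tmx phi theta *m phase_mx theta.

Lemma sum4 (F : 'I_(2 * 2) -> C) :
  \sum_i F i = F (@Ordinal (2 * 2) 0 isT) + F (@Ordinal (2 * 2) 1 isT)
    + F (@Ordinal (2 * 2) 2 isT) + F (@Ordinal (2 * 2) 3 isT).
Proof.
rewrite (big_ord_recr 3) /= (big_ord_recr 2) /= (big_ord_recr 1) /= big_ord1.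
by congr (F _ + F _ + F _ + F _); exact: val_inj.
Qed.

Lemma mx22_adj (s : seq (seq C)) (i j : 'I_(2 * 2)) :
  (mx22 s) ^t* i j = Num.conj (nth 0 (nth [::] s j) i).
Proof. by rewrite !mxE. Qed.

(** The dimensions [2 * 2] and [2 + 2] are convertible, and the first qubit is the high-order index:
    its matrix elements are the blocks. *)
Lemma block_mx22 (A B D E : 'M[C]_2) :
  block_mx A B D E = mx22 [:: [:: A 0 0; A 0 1; B 0 0; B 0 1];
    [:: A 1 0; A 1 1; B 1 0; B 1 1]; [:: D 0 0; D 0 1; E 0 0; E 0 1];
    [:: D 1 0; D 1 1; E 1 0; E 1 1]] :> 'M[C]_(2 * 2).
Proof.
have o0 (h : (0 < 2)%N) : Ordinal h = 0 :> 'I_2 by exact: val_inj.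
have o1 (h : (1 < 2)%N) : Ordinal h = 1 :> 'I_2 by exact: val_inj.
apply/matrixP => i j; rewrite [RHS]mxE.
case: (split_ordP (i : 'I_(2 + 2))) => i' ->;
  case: (split_ordP (j : 'I_(2 + 2))) => j' ->;
  case: i' => [[|[|//]] ?]; case: j' => [[|[|//]] ?]; rewrite /= ?o0 ?o1;
  first [exact: block_mxEul | exact: block_mxEur
        |exact: block_mxEdl | exact: block_mxEdr].
Qed.

Let alpha (phi theta : R) : C := 'i%C * cis (- phi) * (sin theta)%:C.

Let alpha_conj phi theta :
  Num.conj (alpha phi theta) = - ('i%C * cis phi * (sin theta)%:C).
Proof.
by rewrite /alpha !rmorphM /= conj_i conj_cis conj_real opprK !mulNr.
Qed.

Let alpha_norm phi theta : alpha phi theta * Num.conj (alpha phi theta) =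
  (sin theta)%:C ^+ 2.
Proof.
rewrite alpha_conj /alpha; have := cisN phi; have := @sqr_i R.
set i := 'i%C; set u := cis (- phi); set v := cis phi; set s := _%:C => i2 uv.
have -> : i * u * s * - (i * v * s) = - (i ^+ 2) * (u * v) * s ^+ 2 by ring.
by rewrite i2 uv opprK !mul1r.
Qed.

(** The middle block has the SU(2) shape (alpha, c; -c, conj alpha), so unitarity reduces to
    |alpha|^2 + c^2 = 1. *)
Let TmxE phi theta : Tmx phi theta = mx22 [:: [:: 1; 0; 0; 0];
  [:: 0; alpha phi theta; (cos theta)%:C; 0];
  [:: 0; - (cos theta)%:C; Num.conj (alpha phi theta); 0]; [:: 0; 0; 0; 1]].
Proof. by rewrite alpha_conj. Qed.

Lemma Tmx_unitary phi theta : (Tmx phi theta) ^t* *m Tmx phi theta = 1%:M.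
Proof.
have := alpha_norm phi theta; rewrite TmxE.
have := conj_real (cos theta).
have : (cos theta)%:C ^+ 2 + (sin theta)%:C ^+ 2 = 1 :> C.
  by rewrite -!rmorphXn -rmorphD /= cos2Dsin2.
move: (alpha _ _) (cos theta)%:C (sin theta)%:C => x c s cs2 cc xx.
have xc : x * Num.conj x + c * c = 1 by rewrite xx addrC -expr2.
have cN : Num.conj (- c) = - c by rewrite rmorphN /= cc.
apply/matrixP => -[[|[|[|[|//]]]] ?] -[[|[|[|[|//]]]] ?];
  rewrite !mxE sum4 !mx22_adj !mxE /= ?rmorph0 ?rmorph1 ?conjCK ?cc ?cN;
  rewrite ?(mul0r, mulr0, add0r, addr0, mulr1, mulrNN) //.
- by rewrite mulrC.
- by rewrite mulNr mulrC subrr.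
- by rewrite mulrN mulrC subrr.
- by rewrite addrC.
Qed.

Lemma phase_mx_unitary theta : (phase_mx theta) ^t* *m phase_mx theta = 1%:M.
Proof.
rewrite /phase_mx tr_diag_mx map_diag_mx mulmx_diag -diag_const_mx.
congr diag_mx; apply/rowP => -[[|[|[|[|//]]]] ?]; rewrite !mxE /=.
- by rewrite rmorph1 mulr1.
- by rewrite rmorph1 mulr1.
- by rewrite rmorph1 mulr1.
- by rewrite conj_cis cisN.
Qed.

Lemma frame_mx_unitary phi theta :
  (frame_mx phi theta) ^t* *m frame_mx phi theta = 1%:M.
Proof.
rewrite /frame_mx adjmxM mulmxA -(mulmxA _ _ (Tmx phi theta)) Tmx_unitary.
by rewrite mulmx1 phase_mx_unitary.
Qed.

Let phaseK theta : phase_mx theta *m (phase_mx theta) ^t* = 1%:M.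
Proof. exact: mulmx1C (phase_mx_unitary theta). Qed.

Lemma lindblad_op_copies a b (k m : R) phi theta :
  lindblad_op a b k m phi theta =
  copies_op (frame_mx phi theta : 'M[C]_(2 + 2)) (qubit_op a b k m).
Proof.
rewrite /lindblad_op /copies_op; set M := mx22 _.
pose B : 'M[C]_(2 * 2) := block_mx (qubit_op a b k m) 0 0 (qubit_op a b k m).
rewrite -[RHS]/(frame_mx phi theta *m B *m (frame_mx phi theta) ^t*).
(* Stated as an intertwining, the conjugation is checked entry by entry; the phases appear only in
   the off-diagonal entries of the lower block. *)
have MD : phase_mx theta *m B = M *m phase_mx theta.
  rewrite /B block_mx22 /phase_mx mul_diag_mx mul_mx_diag; apply/matrixP.
  have e2 := cisN (2 * theta).
  move=> -[[|[|[|[|//]]]] ?] -[[|[|[|[|//]]]] ?]; rewrite !mxE /=;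
    rewrite ?(mul0r, mulr0, mul1r, mulr1) //.
  - by rewrite mulrAC e2 mul1r.
  - by rewrite mulrC.
rewrite /frame_mx adjmxM !mulmxA -(mulmxA _ (phase_mx theta) B) MD.
by rewrite !mulmxA -(mulmxA _ (phase_mx theta)) phaseK mulmx1.
Qed.

(** [Tmx] mixes only |01> and |10>, which share the energy [E0 + E1], and the phase matrix is
    diagonal; hence the frame commutes with the Hamiltonian. *)
Lemma hamiltonian_copies (E0 E1 : R) phi theta :
  hamiltonian E0 E1 =
  copies_hamiltonian (frame_mx phi theta : 'M[C]_(2 + 2)) (H0 E0 E1) E0 E1.
Proof.
pose d : 'rV[C]_(2 * 2) := \row_j
  nth 0 [:: E0%:C + E0%:C; E0%:C + E1%:C; E0%:C + E1%:C; E1%:C + E1%:C] j.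
have HE : hamiltonian E0 E1 = diag_mx d.
  apply/matrixP => i j; case: (mxtens_indexP i) => i0 i1.
  case: (mxtens_indexP j) => j0 j1; rewrite [LHS]mxE !tensmxE !mxE.
  case: i0 => [[|[|//]] ?]; case: i1 => [[|[|//]] ?];
  case: j0 => [[|[|//]] ?]; case: j1 => [[|[|//]] ?] /=;
  by rewrite ?(mulr0n, mulr1n, mulr0, mulr1, mul0r, mul1r, addr0, add0r) // addrC.
have BE : block_mx (H0 E0 E1 + E0%:C%:M) 0 0 (H0 E0 E1 + E1%:C%:M) =
    diag_mx d :> 'M[C]_(2 * 2).
  rewrite block_mx22; apply/matrixP => -[[|[|[|[|//]]]] ?] -[[|[|[|[|//]]]] ?];
    rewrite !mxE /= ?(mulr0n, mulr1n, addr0, add0r) //.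
  by rewrite addrC.
rewrite /copies_hamiltonian HE.
rewrite -[RHS]/(frame_mx phi theta *m _ *m (frame_mx phi theta) ^t*) BE.
have dU : frame_mx phi theta *m diag_mx d = diag_mx d *m frame_mx phi theta.
  rewrite /frame_mx -mulmxA [phase_mx theta *m _]diag_mxC !mulmxA.
  congr (_ *m _); rewrite mul_diag_mx mul_mx_diag; apply/matrixP.
  move=> -[[|[|[|[|//]]]] ?] -[[|[|[|[|//]]]] ?]; rewrite !mxE /=;
    by rewrite ?(mul0r, mulr0, mul1r, mulr1) // mulrC.
by rewrite dU -mulmxA (mulmx1C (frame_mx_unitary phi theta)) mulmx1.
Qed.

End TwoQubitFrame.

(** * Coherences of steady states and density matrices *)

Section Visibility.
Context {R : realType}.
Local Notation C := R[i].
Local Notation normc := ComplexField.Normc.normc.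
Implicit Types (phi theta : R) (a b c d : C).

Definition steady2 phi theta : C -> C -> C -> C -> 'M[C]_(2 * 2) :=
  @steady R 2 (frame_mx phi theta).

Lemma steady_adj p (U : 'M[C]_(p + p)) a b c d : (steady U a b c d) ^t* =
  steady U (Num.conj a) (Num.conj c) (Num.conj b) (Num.conj d).
Proof.
rewrite /steady !adjmxM adjmxK adjmx_block mulmxA.
by rewrite !tr_scalar_mx !map_scalar_mx.
Qed.

(** The two terms come from the entries (00, 10) and (01, 11); the second meets the conjugate of the
    phase on |11>. For the second qubit the pairs are (00, 01) and (10, 11), and the sign is
    reversed. *)
Definition coherence_factor1 phi theta : C :=
  'i%C * cis (- phi) * (sin theta)%:C * (1 + cis (- (2 * theta))).

Definition coherence_factor2 theta : C :=
  (cos theta)%:C * (1 - cis (- (2 * theta))).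

Lemma steady2E phi theta a b c d (i j : 'I_(2 * 2)) :
  steady2 phi theta a b c d i j =
  let al := 'i%C * cis (- phi) * (sin theta)%:C in
  let co := (cos theta)%:C in
  let e := cis (2 * theta) in
  let U i := nth [::] [:: [:: 1; 0; 0; 0]; [:: 0; al; co; 0];
    [:: 0; - co; - ('i%C * cis phi * (sin theta)%:C); 0]; [:: 0; 0; 0; e]] i in
  let u i k := nth 0 (U i) k in
  (u i 0 * a + u i 2 * c) * Num.conj (u j 0) +
  (u i 1 * a + u i 3 * c) * Num.conj (u j 1) +
  (u i 0 * b + u i 2 * d) * Num.conj (u j 2) +
  (u i 1 * b + u i 3 * d) * Num.conj (u j 3).
Proof.
pose B : 'M[C]_(2 * 2) :=
  block_mx (a%:M : 'M[C]_2) (b%:M : 'M[C]_2) (c%:M : 'M[C]_2) (d%:M : 'M[C]_2).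
rewrite -[LHS]/((frame_mx phi theta *m B *m (frame_mx phi theta) ^t*) i j).
have BE : B = mx22 [:: [:: a; 0; b; 0]; [:: 0; a; 0; b];
    [:: c; 0; d; 0]; [:: 0; c; 0; d]].
  by rewrite /B block_mx22 !mxE.
have UE (k l : 'I_(2 * 2)) : frame_mx phi theta k l = nth 0 (nth [::]
    [:: [:: 1; 0; 0; 0]; [:: 0; 'i%C * cis (- phi) * (sin theta)%:C; (cos theta)%:C; 0];
    [:: 0; - (cos theta)%:C; - ('i%C * cis phi * (sin theta)%:C); 0];
    [:: 0; 0; 0; cis (2 * theta)]] k) l.
  rewrite /frame_mx /phase_mx mul_mx_diag !mxE.
  by case: l => [[|[|[|[|//]]]] ?]; case: k => [[|[|[|[|//]]]] ?] /=;
    rewrite ?mulr1 ?mul0r ?mul1r.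
have UE' (k l : 'I_(2 * 2)) :
    (frame_mx phi theta) ^t* k l = Num.conj (frame_mx phi theta l k).
  by rewrite 2!mxE.
have FB (k l : 'I_(2 * 2)) : (frame_mx phi theta *m B) k l =
    \sum_m frame_mx phi theta k m * B m l by rewrite mxE.
rewrite mxE sum4 !FB !UE' !sum4 BE !UE !mxE /=.
by rewrite !(mulr0, addr0, add0r).
Qed.

Lemma reduced1_steady phi theta a b c d :
  reduced1 (steady2 phi theta a b c d) 0 1 = coherence_factor1 phi theta * b.
Proof.
rewrite mxE !big_ord_recl big_ord0 !steady2E /=.
rewrite /coherence_factor1 ?rmorph0 !rmorphN !rmorphM /= conj_i !conj_cis !conj_real.
by ring.
Qed.

Lemma reduced2_steady phi theta a b c d :
  reduced2 (steady2 phi theta a b c d) 0 1 = coherence_factor2 theta * b.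
Proof.
rewrite mxE !big_ord_recl big_ord0 !steady2E /=.
rewrite /coherence_factor2 !(rmorph0, rmorphM) /= conj_i !conj_cis !conj_real.
by ring.
Qed.

Lemma sin_double theta : sin (2 * theta) = 2 * (sin theta * cos theta).
Proof. by rewrite !mulr_natl sin_mulr2n mulrC. Qed.

(** Factoring out e^{-i theta} leaves 2 cos theta, to be multiplied by sin theta; for the second
    qubit sine and cosine trade places. [phi] enters through a unit factor only. *)
Lemma normc_factor1 phi theta :
  normc (coherence_factor1 phi theta) = `|sin (2 * theta)|.
Proof.
rewrite /coherence_factor1.
have -> : 1 + cis (- (2 * theta)) = cis (- theta) * (2 * cos theta)%:C.
  have -> : 1 + cis (- (2 * theta)) = cis (- theta) * (cis (- theta) + cis theta).
    by rewrite mulrDr cisN -cisD addrC; congr (cis _ + _); ring.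
  congr (_ * _); apply/eqP; rewrite eq_complex /= cosN sinN addNr eqxx andbT.
  by apply/eqP; ring.
rewrite !ComplexField.Normc.normcM !normc_cis.
have -> : normc 'i%C = 1 :> R by rewrite /= expr0n expr1n add0r sqrtr1.
by rewrite !normc_real !mul1r -normrM sin_double; congr `|_|; ring.
Qed.

Lemma normc_factor2 theta :
  normc (coherence_factor2 theta) = `|sin (2 * theta)|.
Proof.
rewrite /coherence_factor2.
have -> : 1 - cis (- (2 * theta)) = cis (- theta) * ('i%C * (2 * sin theta)%:C).
  have -> : 1 - cis (- (2 * theta)) = cis (- theta) * (cis theta - cis (- theta)).
    by rewrite mulrBr cisN -cisD; congr (_ - cis _); ring.
  congr (_ * _); apply/eqP; rewrite eq_complex /= cosN sinN.
  by apply/andP; split; apply/eqP; ring.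
rewrite !ComplexField.Normc.normcM !normc_cis.
have -> : normc 'i%C = 1 :> R by rewrite /= expr0n expr1n add0r sqrtr1.
by rewrite !normc_real !mul1r -normrM sin_double; congr `|_|; ring.
Qed.

Lemma density_conj n (U rho : 'M[C]_n) : U *m U ^t* = 1%:M ->
  density rho -> density (U ^t* *m rho *m U).
Proof.
move=> uU [hrho prho trho]; split.
- by rewrite !adjmxM adjmxK hrho mulmxA.
- move=> v; have := prho (U *m v).
  by rewrite adjmxM !mulmxA.
- by rewrite mxtrace_mulC mulmxA uU mul1mx.
Qed.

Lemma density_offdiag n (rho : 'M[C]_n) (i j : 'I_n) : density rho ->
  2 * `|rho i j| <= rho i i + rho j j.
Proof.
move=> [hrho prho _].
have form (w : C) : 0 <= rho i i + w * rho i j + Num.conj w * rho j i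
    + Num.conj w * w * rho j j.
  have := prho (delta_mx i 0 + w *: delta_mx j 0).
  have -> : (delta_mx i 0 + w *: delta_mx j 0 : 'cV[C]_n) ^t* =
      delta_mx 0 i + Num.conj w *: delta_mx 0 j.
    apply/matrixP => k l; rewrite !mxE rmorphD rmorphM /= !rmorph_nat.
    by rewrite ![(k == 0) && _]andbC.
  rewrite mulmxDl -scalemxAl -!rowE mulmxDr mulmxDl -!scalemxAr -!scalemxAl.
  rewrite mulmxDl -scalemxAl -!colE !mxE; congr (0 <= _); ring.
have rji : rho j i = Num.conj (rho i j) by rewrite -{1}hrho !mxE.
have [x0|x0] := eqVneq (rho i j) 0.
  rewrite x0 normr0 mulr0; have := form 1; rewrite rji x0 rmorph0 rmorph1.
  by rewrite !mulr0 !addr0 !mul1r.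
have n0 : `|rho i j| != 0 by rewrite normr_eq0.
(* This unit phase turns both cross terms of the quadratic form into [- |rho i j|]. *)
have := form (- Num.conj (rho i j) / `|rho i j|).
rewrite rmorphM rmorphN /= conjCK fmorphV /= conj_normC rji => h; rewrite -subr_ge0; move: h.
have := normCK (rho i j).
move: (rho i i) (rho j j) (rho i j) (Num.conj (rho i j)) `|_| n0.
move=> p q x y r r0 rxy; congr (0 <= _).
transitivity (p - 2 * (x * y) / r + (x * y) / r ^+ 2 * q); first by field.
by rewrite -rxy; field.
Qed.

(* The coherences of the pair (i, p + i) are dominated by the populations. *)
Lemma density_offblock p (rho : 'M[C]_(p + p)) : density rho ->
  normc (\tr (ursubmx rho)) <= 2^-1.
Proof.
move=> drho.
have h : 2 * `|\tr (ursubmx rho)| <= 1 :> C.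
  have [_ _ tr1] := drho; rewrite -[leRHS]tr1.
  apply: (@le_trans _ _ (\sum_i 2 * `|rho (lshift p i) (rshift p i)|)).
    rewrite -mulr_sumr ler_wpM2l //.
    rewrite [\tr _](eq_bigr (fun i => rho (lshift p i) (rshift p i))) => [|i _].
      exact: ler_norm_sum.
    by rewrite !mxE.
  rewrite /mxtrace big_split_ord /= -big_split; apply: ler_sum => i _.
  exact: density_offdiag.
have e (r : R) : (2 * r)%:C = 2 * r%:C :> C by rewrite rmorphM rmorph_nat.
have : (2 * normc (\tr (ursubmx rho)))%:C <= (1 : R)%:C.
  by rewrite e -normc_normr.
by rewrite lecR -[2^-1]mul1r ler_pdivlMr // mulrC.
Qed.

Lemma density_real_block p (rho : 'M[C]_(p + p)) : density rho ->
  [/\ Num.conj (\tr (ulsubmx rho)) = \tr (ulsubmx rho),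
      Num.conj (\tr (ursubmx rho)) = \tr (dlsubmx rho) &
      Num.conj (\tr (drsubmx rho)) = \tr (drsubmx rho)].
Proof.
move=> [hrho _ _]; rewrite -!mxtrace_adj.
have e i j : Num.conj (rho i j) = rho j i by rewrite -{2}hrho !mxE.
by split; congr (\tr _); apply/matrixP => i j; rewrite !mxE e.
Qed.

(** To be read in the frame: basis vectors 0 and 2 have equal weight and coherence [z], which is the
    trace of the upper right block. At z = 1/2 the state is a pure equal superposition and saturates
    the positivity bound. *)
Definition cat_state (z : R) : 'M[C]_(2 * 2) :=
  mx22 [:: [:: 2^-1; 0; z%:C; 0]; [:: 0; 0; 0; 0];
           [:: z%:C; 0; 2^-1; 0]; [:: 0; 0; 0; 0]].

Lemma density_cat_state (z : R) : 0 <= z <= 2^-1 -> density (cat_state z).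
Proof.
move=> /andP[z0 z2]; split.
- apply/matrixP => -[[|[|[|[|//]]]] ?] -[[|[|[|[|//]]]] ?];
    rewrite mx22_adj !mxE /= ?rmorph0 ?conj_real //;
    by rewrite fmorphV rmorph_nat.
- move=> v; rewrite mxE sum4 !mxE !sum4 !mxE /=.
  move: (v (@Ordinal (2 * 2) 0 isT) 0) (v (@Ordinal (2 * 2) 2 isT) 0) => x x'.
  have -> : 2^-1 = (2^-1 : R)%:C by rewrite fmorphV rmorph_nat.
  rewrite !(mulr0, mul0r, addr0, add0r).
  have zz : 0 <= (2^-1 - z)%:C :> C by rewrite ler0c subr_ge0.
  have z0' : 0 <= z%:C :> C by rewrite ler0c.
  (* The quadratic form becomes (1/2 - z)(|x|^2 + |x'|^2) + z |x + x'|^2. *)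
  have -> : 2^-1%:C = (2^-1 - z)%:C + z%:C :> C by rewrite -rmorphD subrK.
  have := addr_ge0 (mulr_ge0 zz (addr_ge0 (exprn_ge0 2 (normr_ge0 x)) (exprn_ge0 2 (normr_ge0 x'))))
    (mulr_ge0 z0' (exprn_ge0 2 (normr_ge0 (x + x')))).
  rewrite !normCK (rmorphD _ x x') /=; congr (0 <= _).
  move: (2^-1 - z)%:C z%:C (Num.conj x) (Num.conj x') => s t u w; ring.
- rewrite /mxtrace sum4 !mxE /= !addr0.
  by rewrite -[2^-1]mul1r -splitr.
Qed.

End Visibility.

(** * Visibility *)

Lemma normc_half (R : realType) (z s : R) : 0 <= z ->
  2 * (ComplexField.Normc.normc (z / 2)%:C * s) = z * s.
Proof.
move=> z0; rewrite normc_real ger0_norm ?divr_ge0 //.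
by rewrite mulrA [2 * _]mulrC divfK // pnatr_eq0.
Qed.

Lemma double_quarter (R : realType) (r : R) : r <= 4^-1 -> 2 * r <= 2^-1.
Proof. by move=> r4; lra. Qed.

Lemma scale_down (R : realType) (s v : R) : 0 <= s -> 0 <= v -> v <= 2^-1 * s ->
  exists2 z, 0 <= z <= 2^-1 & z * s = v.
Proof.
move=> s0 v0 v1; have [se|sn] := eqVneq s 0.
  exists 0; first by rewrite lexx invr_ge0 ler0n.
  by apply/eqP; rewrite mul0r eq_le v0 /=; move: v1; rewrite se mulr0.
exists (v / s); last by rewrite divfK.
by rewrite divr_ge0 //= ler_pdivrMr // lt_def sn.
Qed.

Section SteadyOscillation.
Context {R : realType}.
Local Notation C := R[i].
Local Notation normc := ComplexField.Normc.normc.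
Variables (E0 E1 : R) (a b : C) (k m phi theta : R).
Hypothesis dE0 : E0 - E1 != 0.
Hypothesis b0 : b != 0.

Let G := lindblad (hamiltonian E0 E1) (lindblad_op a b k m phi theta).
Let dE := E0 - E1.
Let U : 'M[C]_(2 + 2) := frame_mx phi theta.
Let uU : U ^t* *m U = 1%:M := frame_mx_unitary phi theta.
Let uU' : U *m U ^t* = 1%:M := mulmx1C uU.

Let GE : G = lindblad (copies_hamiltonian U (H0 E0 E1) E0 E1)
  (copies_op U (qubit_op a b k m)) :> ('M[C]_(2 + 2) -> 'M[C]_(2 + 2)).
Proof. by rewrite /G lindblad_op_copies (hamiltonian_copies E0 E1 phi theta). Qed.

Let eigen_scalar A lam : lindblad (H0 E0 E1) (qubit_op a b k m) A = lam *: A ->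
  0 <= complex.Re lam -> exists x, A = x%:M.
Proof. exact: qubit_eigen_scalar. Qed.

Lemma asymptotic_start2P (rho X : 'M[C]_(2 * 2)) :
  asymptotic_start G rho X <-> X = steady_part U rho.
Proof.
rewrite GE; have := asymptotic_startP E0 E1 (isT : 0 < 2)%N uU
  (qubit_op_normal a b k m) eigen_scalar rho X.
by apply.
Qed.

Lemma semigroup_steady2 t x y z w :
  semigroup G t (steady2 phi theta x y z w) =
  steady2 phi theta x (cis (- dE * t) * y) (cis (dE * t) * z) w.
Proof.
rewrite GE.
exact: (semigroup_steady (H0 E0 E1) E0 E1 uU (qubit_op_normal a b k m)).
Qed.

(** The bound 1/4 is 1/2 for the block trace, divided by the block size 2. *)
Lemma steady_part_density (rho : 'M[C]_(2 * 2)) : density rho ->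
  exists x y w, [/\ steady_part U rho = steady2 phi theta x y (Num.conj y) w,
    Num.conj x = x, Num.conj w = w,
    y = \tr (ursubmx (frame U rho)) / 2 & normc y <= 4^-1].
Proof.
move=> drho; have dM : density (frame U rho) by exact: density_conj.
have [cx cy cw] := density_real_block dM.
have c2 (z : C) : Num.conj (z / 2) = Num.conj z / 2.
  by rewrite rmorphM fmorphV rmorph_nat.
exists (\tr (ulsubmx (frame U rho)) / 2), (\tr (ursubmx (frame U rho)) / 2).
exists (\tr (drsubmx (frame U rho)) / 2).
split; [by rewrite c2 cy|by rewrite c2 cx|by rewrite c2 cw|by []|].
have := density_offblock dM; rewrite ComplexField.Normc.normcM.
have -> : normc (2^-1 : C) = 2^-1.
  rewrite ComplexField.Normc.normcV; congr (_ ^-1).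
  have -> : (2 : C) = (2 : R)%:C by rewrite rmorph_nat.
  by rewrite normc_real normr_nat.
move=> h; apply: le_trans (_ : 2^-1 * 2^-1 <= _).
  by rewrite ler_wpM2r // invr_ge0.
by rewrite -invfM -natrM.
Qed.

Let steady_coherence x y z w t :
  normc (reduced1 (semigroup G t (steady2 phi theta x y z w)) 0 1) =
    normc y * `|sin (2 * theta)| /\
  normc (reduced2 (semigroup G t (steady2 phi theta x y z w)) 0 1) =
    normc y * `|sin (2 * theta)|.
Proof.
rewrite semigroup_steady2 reduced1_steady reduced2_steady.
rewrite (ComplexField.Normc.normcM (coherence_factor1 _ _)).
rewrite (ComplexField.Normc.normcM (coherence_factor2 _)).
rewrite (ComplexField.Normc.normcM _ y) normc_factor1 normc_factor2 normc_cis.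
by rewrite mul1r; split; exact: mulrC.
Qed.

Lemma coherence_steady x y z w :
  coherence G (steady2 phi theta x y z w) (normc y * `|sin (2 * theta)|).
Proof. by move=> t _; exact: steady_coherence. Qed.

Lemma mxtrace_sigma_x (r : 'M[C]_2) : \tr (sigma_x *m r) = r 0 1 + r 1 0.
Proof.
rewrite /mxtrace !big_ord_recl big_ord0 !mxE !big_ord_recl !big_ord0 !mxE /=.
rewrite !mul0r !mul1r !addr0 !add0r addrC.
by congr (r _ _ + r _ _); exact: val_inj.
Qed.

Lemma adj_reduced1 (X : 'M[C]_(2 * 2)) : (reduced1 X) ^t* = reduced1 (X ^t*).
Proof.
by apply/matrixP => i j; rewrite !mxE rmorph_sum; apply: eq_bigr => l _; rewrite !mxE.
Qed.

Lemma adj_reduced2 (X : 'M[C]_(2 * 2)) : (reduced2 X) ^t* = reduced2 (X ^t*).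
Proof.
by apply/matrixP => i j; rewrite !mxE rmorph_sum; apply: eq_bigr => l _; rewrite !mxE.
Qed.

Let sigma_x_oscillation (F : C) : exists mu : R, forall (r : 'M[C]_2) (t : R),
  r ^t* = r -> r 0 1 = F * cis (- dE * t) ->
  \tr (sigma_x *m r) = (2 * normc F * cos (dE * t + mu))%:C.
Proof.
(* The coherence rotates as e^{-i dE t}, so the phase of the cosine is minus the argument of [F]. *)
have [mu FE] := polar_form F; exists (- mu) => r t hr r01.
have r10 : r 1 0 = Num.conj (r 0 1) by rewrite -{1}hr !mxE.
rewrite mxtrace_sigma_x r10.
have -> : r 0 1 = (normc F)%:C * cis (- (dE * t - mu)).
  by rewrite r01 {1}FE -mulrA -cisD; congr (_ * cis _); ring.
rewrite rmorphM /= conj_real conj_cis opprK.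
apply/eqP; rewrite eq_complex /= cosN sinN.
by apply/andP; split; apply/eqP; ring.
Qed.

Lemma oscillates_steady x y w : Num.conj x = x -> Num.conj w = w ->
  oscillates G dE (steady2 phi theta x y (Num.conj y) w)
    (2 * (normc y * `|sin (2 * theta)|)).
Proof.
move=> cx cw; have herm t :
    (semigroup G t (steady2 phi theta x y (Num.conj y) w)) ^t* =
    semigroup G t (steady2 phi theta x y (Num.conj y) w).
  have cc (u : R) v : Num.conj (cis u * v) = cis (- u) * Num.conj v.
    by rewrite rmorphM /= conj_cis.
  have sa x' y' z' w' : (steady2 phi theta x' y' z' w') ^t* = steady2 phi theta
      (Num.conj x') (Num.conj z') (Num.conj y') (Num.conj w').
    exact: (steady_adj U x' y' z' w').
  rewrite semigroup_steady2 sa cx cw !cc conjCK.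
  by rewrite mulNr opprK.
split.
  have [mu osc] := sigma_x_oscillation (coherence_factor1 phi theta * y).
  exists mu => t _; rewrite (osc _ t).
  - by rewrite (ComplexField.Normc.normcM _ y) normc_factor1 [normc y * _]mulrC.
  - by rewrite adj_reduced1 herm.
  - by rewrite semigroup_steady2 reduced1_steady [cis _ * y]mulrC mulrA.
have [mu osc] := sigma_x_oscillation (coherence_factor2 theta * y).
exists mu => t _; rewrite (osc _ t).
- by rewrite (ComplexField.Normc.normcM _ y) normc_factor2 [normc y * _]mulrC.
- by rewrite adj_reduced2 herm.
- by rewrite semigroup_steady2 reduced2_steady [cis _ * y]mulrC mulrA.
Qed.

Lemma steady_part_cat_state (z : R) :
  exists x w, steady_part U (U *m cat_state z *m U ^t*) =
    steady2 phi theta x (z / 2)%:C (z / 2)%:C w.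
Proof.
pose M : 'M[C]_(2 + 2) := cat_state z.
have fM : frame U (U *m M *m U ^t*) = M.
  exact: (unframe uU M).
exists (\tr (ulsubmx M) / 2), (\tr (drsubmx M) / 2).
rewrite /steady_part -[cat_state z]/M fM.
have h2 : (z / 2)%:C = z%:C / 2 :> C by rewrite rmorphM fmorphV rmorph_nat.
have -> : \tr (ursubmx M) = z%:C.
  by rewrite /mxtrace !big_ord_recl big_ord0 !mxE /= !addr0.
have -> : \tr (dlsubmx M) = z%:C.
  by rewrite /mxtrace !big_ord_recl big_ord0 !mxE /= !addr0.
by rewrite h2.
Qed.

Theorem visibilitiesE : visibilities G = `[0, 2^-1 * `|sin (2 * theta)|]%classic.
Proof.
apply/seteqP; split=> v /=.
  move=> [rho [X [y [drho /asymptotic_start2P XE cohX ->]]]].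
  have [x [q [w [sE _ _ _ q4]]]] := steady_part_density drho.
  have [cX _] := cohX 0 (lexx 0).
  have XS : X = steady2 phi theta x q (Num.conj q) w := etrans XE sE.
  have [cS _] := steady_coherence x q (Num.conj q) w 0.
  (* The value at time 0 already determines [y]. *)
  have -> : y = normc q * `|sin (2 * theta)| by rewrite -cX XS; exact: cS.
  rewrite in_itv /= mulrA; apply/andP; split.
    by rewrite !mulr_ge0 ?normc_ge0.
  apply: ler_wpM2r; first exact: normr_ge0.
  exact: double_quarter.
rewrite in_itv /= => /andP[v0 v1].
have [z z02 zs] := scale_down (normr_ge0 (sin (2 * theta))) v0 v1.
have [x [w xw]] := steady_part_cat_state z.
pose rho : 'M[C]_(2 * 2) := U *m cat_state z *m U ^t*.
exists rho, (steady2 phi theta x (z / 2)%:C (z / 2)%:C w).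
exists (normc (z / 2)%:C * `|sin (2 * theta)|); split.
- have uU2 : U ^t* *m (U ^t*) ^t* = 1%:M by rewrite adjmxK.
  have dz : density (cat_state z) by exact: density_cat_state.
  by have := density_conj uU2 dz; rewrite adjmxK.
- by apply/asymptotic_start2P; exact/esym.
- exact: coherence_steady.
- have /andP[z0 _] := z02.
  by rewrite -zs; exact/esym/normc_half.
Qed.

Theorem asymptotic_dynamics (rho : 'M[C]_(2 * 2)) : density rho ->
  (exists! X : 'M[C]_(2 * 2), asymptotic_start G rho X) /\
  (forall X : 'M[C]_(2 * 2), asymptotic_start G rho X ->
     exists y : R, coherence G X y /\ oscillates G dE X (2 * y)).
Proof.
move=> drho; split.
  exists (steady_part U rho); split; first exact/asymptotic_start2P.
  by move=> X /asymptotic_start2P ->.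
move=> X /asymptotic_start2P XE.
have [x [q [w [sE cx cw _ _]]]] := steady_part_density drho.
have -> : X = steady2 phi theta x q (Num.conj q) w := etrans XE sE.
exists (normc q * `|sin (2 * theta)|); split; first exact: coherence_steady.
exact: oscillates_steady.
Qed.

End SteadyOscillation.

(** Here [2 * theta] lies strictly between -pi and pi and its cosine vanishes; injectivity of the
    cosine on [0, pi] applies to it or to its opposite. *)
Lemma abs_sin_double_eq1 (R : realType) (theta : R) : admissible theta ->
  `|sin (2 * theta)| = 1 <-> theta = pi / 4 \/ theta = - (pi / 4).
Proof.
move=> [t1 t2 _]; have p0 := pi_gt0 R; split.
  move=> /sin1cos0 c0.
  have pih : (pi / 2 : R) \in `[0, pi]%R.
    by rewrite in_itv /=; apply/andP; split; lra.
  have [t0|t0] := leP 0 theta.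
    left; have : 2 * theta = pi / 2.
      apply: cos_inj => //; last by rewrite c0 cos_pihalf.
      by rewrite in_itv /=; apply/andP; split; lra.
    by lra.
  right; have : - (2 * theta) = pi / 2.
    apply: cos_inj => //; last by rewrite cosN c0 cos_pihalf.
    by rewrite in_itv /=; apply/andP; split; lra.
  by lra.
case=> ->.
  rewrite (_ : 2 * (pi / 4) = pi / 2); last by field.
  by rewrite sin_pihalf normr1.
rewrite (_ : 2 * - (pi / 4) = - (pi / 2)); last by field.
by rewrite sinN sin_pihalf normrN1.
Qed.

Theorem mainTheorem9 (R : realType) (E0 E1 : R) (a b : R[i]) (k m phi : R)
    (hE : E0 - E1 != 0) (hb : b != 0) (hphi : 0 <= phi < 2 * pi) :
  let G (theta : R) :=
    lindblad (hamiltonian E0 E1) (lindblad_op a b k m phi theta) in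
  (forall theta : R, admissible theta ->
     (* the asymptotic dynamics, |y| and the visibility are well defined *)
     (forall rho : 'M[R[i]]_(2 * 2), density rho ->
        (exists! X : 'M[R[i]]_(2 * 2), asymptotic_start (G theta) rho X) /\
        (forall X : 'M[R[i]]_(2 * 2), asymptotic_start (G theta) rho X ->
           exists y : R, coherence (G theta) X y /\
             oscillates (G theta) (E0 - E1) X (2 * y))) /\
     (* the range of the visibility *)
     visibilities (G theta) = `[0, 2^-1 * `|sin (2 * theta)|]%classic) /\
  (* the largest maximum over all admissible theta *)
  (forall theta : R, admissible theta ->
     sup (visibilities (G theta)) <= 2^-1 /\
     (sup (visibilities (G theta)) = 2^-1 <->
      theta = pi / 4 \/ theta = - (pi / 4))).
Proof.
move=> G; split=> theta adm.
  split; last exact: visibilitiesE.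
  by move=> rho; exact: asymptotic_dynamics.
have -> : visibilities (G theta) = `[0, 2^-1 * `|sin (2 * theta)|]%classic.
  exact: visibilitiesE.
have v0 : 0 <= 2^-1 * `|sin (2 * theta)| by rewrite mulr_ge0 ?invr_ge0.
(* The interval is closed, so its supremum is a visibility that actually occurs. *)
rewrite sup_itvcc //; split.
  by rewrite ler_piMr ?invr_ge0 // ler_norml sin_geN1 sin_le1.
rewrite -(abs_sin_double_eq1 adm); split=> [h|->]; last by rewrite mulr1.
have h2 : (2^-1 : R) != 0 by rewrite invr_neq0.
by apply: (mulfI h2); rewrite h mulr1.
Qed.
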